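(* Let $K$ be a number field of degree $n=[K:\mathbb{Q}]$ whose ring of integers $\mathcal{O}$ is a principal ideal domain, let $m\ge 2$ be an integer, and let $S\subseteq\mathcal{O}^m$ be an admissible finite set. Then $$D(V(S))=\prod_{\mathfrak{p}\in\mathcal{P}_{\mathcal{O}}}\left(1-\frac{|S|}{N(\mathfrak{p})^m}\right),$$ where the density $D$ is taken, for any $\mathbb{Z}$-basis $\mathbb{E}$ of $\mathcal{O}$, along the averaging sets $C[L,\mathbb{E}]$ (as $L\to\infty$) or $B[R,\mathbb{E}]$ (as $R\to\infty$).
   Context: For $\mathbf{a}=(a_1,\dots,a_m)\in\mathcal{O}^m$, $\gcd(\mathbf{a})$ denotes the ideal $\gcd((a_1),\dots,(a_m))$, i.e. the smallest ideal of $\mathcal{O}$ containing all the principal ideals $(a_i)$. Two points $\mathbf{a},\mathbf{b}\in\mathcal{O}^m$ are mutually visible if $\gcd(\mathbf{a}-\mathbf{b})=\mathcal{O}$. A finite set $S\subseteq\mathcal{O}^m$ is admissible if any two distinct elements of $S$ are mutually visible. For a finite set $S\subseteq\mathcal{O}^m$, $$V(S)=\{\mathbf{z}\in\mathcal{O}^m : \gcd(\mathbf{z}-\mathbf{x})=\mathcal{O}\ \text{for all } \mathbf{x}\in S\}.$$ $\mathcal{P}_{\mathcal{O}}$ is the set of nonzero prime ideals of $\mathcal{O}$ and $N(\mathfrak{p})=|\mathcal{O}/\mathfrak{p}|$. For a $\mathbb{Z}$-basis $\mathbb{E}=\{e_1,\dots,e_n\}$ of $\mathcal{O}$ put $$C[L,\mathbb{E}]=\Big\{\sum_{i=1}^n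 a_ie_i : a_i\in[-L,L]\cap\mathbb{Z}\Big\}\ (L\in\mathbb{N}),\qquad B[R,\mathbb{E}]=\Big\{\sum_{i=1}^n a_ie_i : a_i\in\mathbb{Z},\ a_1^2+\dots+a_n^2\le R^2\Big\}\ (R>0).$$ Here $\mathrm{vol}(C[L,\mathbb{E}])=(2L)^n$ and $\mathrm{vol}(B[R,\mathbb{E}])$ is the Lebesgue volume of the Euclidean ball of radius $R$ in $\mathbb{R}^n$. The density of $T\subseteq\mathcal{O}^m$ along the sets $A=C[L,\mathbb{E}]$ (resp. $A=B[R,\mathbb{E}]$) is the limit of $|A^m\cap T|/\mathrm{vol}(A)^m$ as $L\to\infty$ (resp. $R\to\infty$), when it exists; it is written $D(T)$ when it is independent of the basis $\mathbb{E}$. *)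

(* Defs.v *)
From HB Require Import structures.
From mathcomp Require Import all_boot all_order all_algebra all_field.
From mathcomp Require Import finmap.
From mathcomp Require Import all_classical all_reals all_analysis.
From mathcomp Require Import showcase.summability.

Set Implicit Arguments.
Unset Strict Implicit.
Unset Printing Implicit Defensive.

Import Order.TTheory GRing.Theory Num.Theory numFieldNormedType.Exports.

Local Open Scope classical_set_scope.
Local Open Scope ring_scope.

(* A number field is a [fieldExtType rat], and its degree
   over the rationals is [\dim {:K}]. *)

Section RingOfIntegers.
Variable K : fieldExtType rat.

Definition integer_pred : {pred K} :=
  fun x => `[< integralOver (intr : int -> K) x >].

Fact integer_subring_closed : subring_closed integer_pred.
Proof.
split; rewrite ?unfold_in.
- by apply/asboolP; exact: integral1.
- move=> x y /asboolP x_int /asboolP y_int.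
  by apply/asboolP; exact: integral_sub.
- move=> x y /asboolP x_int /asboolP y_int.
  by apply/asboolP; exact: integral_mul.
Qed.

HB.instance Definition _ :=
  GRing.isSubringClosed.Build K integer_pred integer_subring_closed.

Record integers := Integer {
  integer_val :> K;
  integer_valP : integer_val \in integer_pred }.

HB.instance Definition _ := [isSub for integer_val].
HB.instance Definition _ := [Choice of integers by <:].
HB.instance Definition _ := [SubChoice_isSubComNzRing of integers by <:].

End RingOfIntegers.

(* The cardinality of a finite set (0 if the set is infinite). *)
Definition card (T : choiceType) (A : set T) : nat := #|` fset_set A|.

Section Ideals.
Variable O : comNzRingType.

(* Unlike [idealr_closed], this allows the unit ideal. *)
Definition is_ideal (I : set O) : Prop :=
  [/\ I 0, forall x y, I x -> I y -> I (x + y) & forall a x, I x -> I (a * x)].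

Definition principal (a : O) : set O := [set c * a | c in [set: O]].

Definition is_PID : Prop :=
  GRing.integral_domain_axiom O /\
  forall I : set O, is_ideal I -> exists a, I = principal a.

Definition nonzero_primes : set (set O) :=
  [set P : set O | [/\ idealr_closed [in P], prime_idealr_closed [in P]
             & P != [set 0]]].

Definition ideal_norm (I : set O) : nat :=
  card [set [set x + y | y in I] | x in [set: O]].

Definition gcd_ideal (m : nat) (a : 'rV[O]_m) : set O :=
  smallest is_ideal (\bigcup_i principal (a 0 i)).

Definition visible (m : nat) (a b : 'rV[O]_m) : Prop :=
  gcd_ideal (a - b) = [set: O].

Definition admissible (m : nat) (S : {fset 'rV[O]_m}) : Prop :=
  forall a b, a \in S -> b \in S -> a != b -> visible a b.

Definition visible_from (m : nat) (S : {fset 'rV[O]_m}) : set 'rV[O]_m :=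
  [set z | forall x, x \in S -> visible z x].

Definition combination (n : nat) (E : 'I_n -> O) (a : 'rV[int]_n) : O :=
  \sum_(i < n) E i *~ a 0 i.

Definition Zbasis (n : nat) (E : 'I_n -> O) : Prop :=
  forall x, exists! a : 'rV[int]_n, x = combination E a.

End Ideals.

Section Averaging.
Variables (R : realType) (O : comNzRingType) (n : nat).

Definition cube_lattice (E : 'I_n -> O) (L : nat) : set O :=
  [set combination E a | a in
    [set a : 'rV[int]_n | forall i, - L%:Z <= a 0 i <= L%:Z]].

Definition ball_lattice (E : 'I_n -> O) (r : R) : set O :=
  [set combination E a | a in
    [set a : 'rV[int]_n | \sum_(i < n) (a 0 i)%:~R ^+ 2 <= r ^+ 2]].

(* Lebesgue (outer) measure on R^n; on Lebesgue measurable sets, in particular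
   on balls, this is the Lebesgue measure. *)
Definition lebesgue_outer (A : set 'rV[R]_n) : \bar R :=
  ereal_inf [set v | exists a b : nat -> 'rV[R]_n,
    [/\ forall k i, a k 0 i <= b k 0 i,
        A `<=` \bigcup_k [set x | forall i, a k 0 i <= x 0 i <= b k 0 i]
      & v = (\sum_(0 <= k <oo) (\prod_(i < n) (b k 0 i - a k 0 i))%:E)%E]].

Definition cube_volume (L : nat) : R := (2 * L%:R) ^+ n.

Definition ball_volume (r : R) : R :=
  fine (lebesgue_outer
    [set x : 'rV[R]_n | \sum_(i < n) x 0 i ^+ 2 <= r ^+ 2]).

Definition proportion (m : nat) (T : set 'rV[O]_m) (A : set O) (vol : R) : R :=
  (card ([set a : 'rV[O]_m | forall i, A (a 0 i)] `&` T))%:R / vol ^+ m.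

End Averaging.

(* The limits exist for all bases E and both averaging families, and all of
   them are equal to d. *)
Definition has_density (R : realType) (K : fieldExtType rat) (m : nat)
    (T : set 'rV[integers K]_m) (d : R) : Prop :=
  forall E : 'I_(\dim {:K}) -> integers K, Zbasis E ->
    (proportion T (cube_lattice E L) (cube_volume R (\dim {:K}) L)
       @[L --> \oo] --> d) /\
    (proportion T (ball_lattice E r) (ball_volume (\dim {:K}) r)
       @[r --> +oo] --> d).

(* Partial products over finite sets of indices in D; their limit along the
   filter [totally] is the product over D, taken without ordering D. *)
Definition partial_prod (R : realType) (I : choiceType) (D : set I)
    (f : I -> R) (A : {fset I}) : R :=
  \prod_(i <- A | i \in D) f i.

Definition infinite_prod (R : realType) (I : choiceType) (D : set I)
    (f : I -> R) : R :=
  lim (partial_prod D f @ totally).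

Definition euler_factor (R : realType) (O : comNzRingType) (m s : nat)
    (P : set O) : R :=
  1 - s%:R / (ideal_norm P)%:R ^+ m.

(* Main.v *)
From mathcomp Require Import all_boot all_order all_algebra all_field.
From mathcomp Require Import perm finmap.
From mathcomp Require Import all_classical all_reals all_analysis.
From mathcomp Require Import showcase.summability.
From mathcomp Require Import zify ring lra.
Require Import Defs.
Import Order.TTheory GRing.Theory Num.Theory numFieldNormedType.Exports.
Set Implicit Arguments.
Unset Strict Implicit.
Unset Printing Implicit Defensive.
Local Open Scope classical_set_scope.
Local Open Scope ring_scope.

(** A point [z] is visible from all of [S] iff no nonzero prime [P] satisfies
[z = x (mod P)] for some [x] in [S]. Admissibility makes the points of [S]
pairwise distinct modulo every [P], so by the Chinese remainder theorem the
conditions at finitely many primes cut out a periodic set of density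
[\prod (1 - |S| / N(P) ^ m)]. All factors lie in [0, 1]; hence the partial
products decrease, their limit is their infimum, and every finite set of primes
gives an upper bound for the density of [V(S)].

For the lower bound one discards the points of the box of side [T] congruent to
some [x] modulo a prime [P] above a rational prime [q > M]. There are at most [n]
primes above each [q], and a coset of [P] meets the box in at most
[(T / q + 1) T ^ (n - 1)] points. Looking at two coordinates only, the primes
[q <= T] contribute a proportion [O(\sum_(q > M) q ^ -2) = O(1 / M)]. If [q > T],
either [z_0 = x_0] or [q] divides the norm of [z_0 - x_0], which is [O(T ^ n)] and
so has at most [n + 1] prime divisors exceeding [T]; this contributes [O(1 / T)].

All this only uses that the averaging sets lie in boxes of comparable volume
and are equidistributed in the residue classes modulo [Q]. For balls the latter
amounts to counting lattice points, which is done by comparison with coverings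
by boxes, the volume being the outer measure. *)

(** * Cardinalities of finite sets *)

Section Cardinality.
Implicit Types (T U : choiceType).

Lemma finite_inj T U (A : set T) (B : set U) (f : T -> U) :
  finite_set B -> (forall x, A x -> B (f x)) ->
  (forall x y, A x -> A y -> f x = f y -> x = y) -> finite_set A.
Proof.
move=> Bfin fB finj.
rewrite -(eq_finite_set (A := f @` A)); last first.
  by apply: inj_card_eq => x y /set_mem Ax /set_mem Ay; exact: finj.
by apply: sub_finite_set Bfin => _ [x Ax <-]; exact: fB.
Qed.

Lemma leq_card_inj T U (A : set T) (B : set U) (f : T -> U) :
  finite_set B -> (forall x, A x -> B (f x)) ->
  (forall x y, A x -> A y -> f x = f y -> x = y) -> (card A <= card B)%N.
Proof.
move=> Bfin fB finj; have Afin := finite_inj Bfin fB finj.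
have <- : #|` [fset f x | x in fset_set A]%fset| = card A.
  rewrite card_in_imfset// => x y /=; rewrite !in_fset_set// => /set_mem Ax /set_mem Ay; exact: finj.
apply: fsubset_leq_card; apply/fsubsetP => _ /imfsetP[x /= xA ->].
by move: xA; rewrite !in_fset_set// => /set_mem Ax; apply/mem_set/fB.
Qed.

Lemma card_sub T (A B : set T) : finite_set B -> A `<=` B -> (card A <= card B)%N.
Proof. by move=> Bfin AB; apply: (leq_card_inj (f := id)). Qed.

Lemma card_eq_bij T U (A : set T) (B : set U) (f : T -> U) (g : U -> T) :
  finite_set B ->
  (forall x, A x -> B (f x)) -> (forall y, B y -> A (g y)) ->
  (forall x, A x -> g (f x) = x) -> (forall y, B y -> f (g y) = y) ->
  card A = card B.
Proof.
move=> Bfin fB gA fK gK.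
have fi x y : A x -> A y -> f x = f y -> x = y.
  by move=> Ax Ay e; rewrite -(fK x)// e fK.
have Afin := finite_inj Bfin fB fi.
apply/eqP; rewrite eqn_leq (leq_card_inj Bfin fB)//=.
apply: (leq_card_inj Afin gA) => x y Bx By e; by rewrite -(gK x)// e gK.
Qed.

Lemma card_finType (F : finType) (A : {set F}) : card [set` A] = #|A|.
Proof.
have -> : #|A| = size (undup (enum A)) by rewrite undup_id ?enum_uniq// -cardE.
rewrite -card_fseq /card; congr (#|` _|); apply/fsetP => x.
by rewrite in_fset_set// !inE mem_enum; apply/idP/idP => [/set_mem|/mem_set].
Qed.

Lemma card_setT (F : finType) : card [set: F] = #|F|.
Proof.
rewrite -[#|F|]cardsT -card_finType; congr card.
by apply/seteqP; split => x //= _; rewrite inE.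
Qed.

Lemma leq_card_finType T (F : finType) (A : set T) (f : T -> F) :
  (forall x y, A x -> A y -> f x = f y -> x = y) -> (card A <= #|F|)%N.
Proof.
move=> finj; rewrite -card_setT; apply: (leq_card_inj (f := f)) => //.
exact: finite_finset.
Qed.

Lemma card_set0 T : card (@set0 T) = 0%N.
Proof. by rewrite /card fset_set0 cardfs0. Qed.

Lemma card_setU_le T (A B : set T) : finite_set A -> finite_set B ->
  (card (A `|` B) <= card A + card B)%N.
Proof. by move=> fA fB; rewrite /card fset_setU// cardfsU leq_subr. Qed.

Lemma card_setU T (A B : set T) : finite_set A -> finite_set B ->
  A `&` B = set0 -> card (A `|` B) = (card A + card B)%N.
Proof.
by move=> fA fB AB; rewrite /card fset_setU// cardfsU -fset_setI// AB fset_set0 cardfs0 subn0.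
Qed.

Lemma set_mem_nil (I : eqType) : [set` [::]] = set0 :> set I.
Proof. by apply/seteqP; split. Qed.

Lemma set_mem_cons (I : eqType) (i : I) (s : seq I) :
  [set` i :: s] = i |` [set` s] :> set I.
Proof.
apply/seteqP; split => j /=; rewrite inE; first by case/orP => [/eqP|]; [left|right].
by case=> [->|->]; rewrite ?eqxx ?orbT.
Qed.

Lemma card_bigcup_le T (I : eqType) (s : seq I) (A : I -> set T) :
  (forall i, i \in s -> finite_set (A i)) ->
  (card (\bigcup_(i in [set` s]) A i) <= \sum_(i <- s) card (A i))%N.
Proof.
elim: s => [_|i s IH fA]; first by rewrite big_nil set_mem_nil bigcup_set0 card_set0.
have fs j : j \in s -> finite_set (A j) by move=> js; apply: fA; rewrite inE js orbT.
rewrite set_mem_cons bigcup_setU1 big_cons.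
apply: leq_trans (card_setU_le _ _) _; rewrite ?leq_add2l ?IH//.
- by apply: fA; rewrite inE eqxx.
- by apply: bigcup_finite => // j /= js; exact: fs.
Qed.

Lemma card_bigcup T (I : eqType) (s : seq I) (A : I -> set T) : uniq s ->
  (forall i, finite_set (A i)) ->
  (forall i j x, i \in s -> j \in s -> A i x -> A j x -> i = j) ->
  card (\bigcup_(i in [set` s]) A i) = (\sum_(i <- s) card (A i))%N.
Proof.
move=> + fA; elim: s => [_ _|i s IH /= /andP[ins us] dA].
  by rewrite big_nil set_mem_nil bigcup_set0 card_set0.
rewrite set_mem_cons bigcup_setU1 big_cons card_setU// ?IH//.
- by move=> j k x js ks; apply: dA; rewrite inE (js, ks) orbT.
- exact: bigcup_finite.
- apply/seteqP; split => // x [Aix [j /= js Ajx]].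
  by move: ins; rewrite (dA i j x) ?js// ?mem_head// inE js orbT.
Qed.

(** Counting by fibres over the first component, where the fibre may vary with the base point. This
    is how pairs with a fixed first coordinate are handled for the large primes. *)
Lemma card_pairs_le T U (A : set T) (B : T -> set U) (k : nat) :
  finite_set A -> (forall x, A x -> finite_set (B x)) ->
  (forall x, A x -> (card (B x) <= k)%N) ->
  (card [set p : T * U | A p.1 /\ B p.1 p.2] <= card A * k)%N.
Proof.
move=> fA fB Bk.
have -> : [set p : T * U | A p.1 /\ B p.1 p.2] =
    \bigcup_(x in [set` fset_set A]) [set p : T * U | p.1 = x /\ B x p.2].
  apply/seteqP; split => [[x y] /= [Ax Bxy]|[x y] [x' x'A] /= [e Bxy]].
    by exists x; [rewrite /= in_fset_set//; exact: mem_set|split].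
  by move: x'A Bxy; rewrite /= -{}e in_fset_set// => /set_mem.
have fib x : A x -> finite_set [set p : T * U | p.1 = x /\ B x p.2].
  move=> Ax; apply: (@finite_inj _ _ _ (B x) snd); first exact: fB.
    by move=> p [].
  by move=> [a b] [c d] /= [-> ?] [-> ?] ->.
apply: leq_trans (card_bigcup_le _) _.
  by move=> x; rewrite in_fset_set// => /set_mem; exact: fib.
rewrite mulnC -iter_addn_0 /card -count_predT -(big_const_seq _ _ _ predT) big_seq [leqRHS]big_seq.
apply: leq_sum => x; rewrite in_fset_set// => /set_mem Ax.
apply: leq_trans (Bk _ Ax); apply: (leq_card_inj (f := snd)); first exact: fB.
  by move=> p [].
by move=> [a b] [c d] /= [-> _] [-> _] ->.
Qed.

Lemma card_setX T U (A : set T) (B : set U) : finite_set A -> finite_set B ->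
  card (A `*` B) = (card A * card B)%N.
Proof.
move=> fA fB.
have -> : A `*` B = \bigcup_(x in [set` fset_set A]) ([set x] `*` B).
  apply/seteqP; split => [[x y] /= [Ax Bxy]|[x y] [x' x'A] /= [e Bxy]].
    by exists x; [rewrite /= in_fset_set//; exact: mem_set|split].
  by move: x'A; rewrite /= -{}e in_fset_set// => /set_mem.
rewrite card_bigcup ?fset_uniq//; first last.
- by move=> x y [a b] _ _ /= [-> _] [-> _].
- by move=> x; apply: finite_setX.
rewrite mulnC -iter_addn_0 {2}/card -(count_predT (fset_set A)) -(big_const_seq _ _ _ predT).
apply: eq_bigr => x _.
apply: (@card_eq_bij _ _ _ _ snd (pair x)) => //=; last by move=> [a b] /= [-> _].
by move=> [a b] [].
Qed.

Definition row_cons (m : nat) T (x : T) (b : 'rV[T]_m) : 'rV[T]_m.+1 :=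
  \row_i if unlift ord0 i is Some j then b 0 j else x.

Lemma row_cons0 m T (x : T) (b : 'rV[T]_m) : row_cons x b 0 ord0 = x.
Proof. by rewrite mxE unlift_none. Qed.

Lemma row_consS m T (x : T) (b : 'rV[T]_m) i : row_cons x b 0 (lift ord0 i) = b 0 i.
Proof. by rewrite mxE liftK. Qed.

Lemma row_consK m T (a : 'rV[T]_m.+1) :
  row_cons (a 0 ord0) (\row_i a 0 (lift ord0 i)) = a.
Proof.
apply/rowP => i; case: (unliftP ord0 i) => [j ->|->]; first by rewrite row_consS mxE.
by rewrite row_cons0.
Qed.

(** Induction on [m], splitting off the first coordinate. Finiteness belongs to the conclusion
    because [card] returns 0 on infinite sets, so that the count alone would be ambiguous. *)
Lemma card_rows m T (A : 'I_m -> set T) : (forall i, finite_set (A i)) ->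
  finite_set [set a : 'rV[T]_m | forall i, A i (a 0 i)] /\
  card [set a : 'rV[T]_m | forall i, A i (a 0 i)] = (\prod_(i < m) card (A i))%N.
Proof.
elim: m A => [|m IH] A fA.
  (* [T] may be empty, so the unique row of length 0 is built from the empty function. *)
  have a0 : 'rV[T]_0 by apply: (matrix_of_fun matrix_key) => _ [].
  have -> : [set a : 'rV[T]_0 | forall i, A i (a 0 i)] = [set a0].
    apply/seteqP; split => a /= _; first by apply/rowP => -[].
    by case.
  by split; [exact: finite_set1|rewrite big_ord0 /card fset_set1 cardfs1].
have [fB cB] := IH (fun i => A (lift ord0 i)) (fun i => fA _).
set B := [set a : 'rV[T]_m | _] in fB cB.
pose h (a : 'rV[T]_m.+1) := (a 0 ord0, \row_i a 0 (lift ord0 i)).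
pose g (p : T * 'rV[T]_m) := row_cons p.1 p.2.
have fX : finite_set (A ord0 `*` B) by apply: finite_setX.
have hX (a : 'rV[T]_m.+1) : (forall i, A i (a 0 i)) -> (A ord0 `*` B) (h a).
  by move=> Aa; split => //= i; rewrite mxE.
have hi : forall a, g (h a) = a by exact: row_consK.
split; first by apply: (finite_inj fX hX) => x y _ _ e; rewrite -(hi x) e hi.
rewrite (@card_eq_bij _ _ _ (A ord0 `*` B) h g)//.
- by rewrite /card -/(card _) card_setX// big_ord_recl -cB.
- move=> [x b] /= [Ax Bb] i; case: (unliftP ord0 i) => [j ->|->]; first by rewrite row_consS.
  by rewrite row_cons0.
- move=> [x b] _; rewrite /h /g /= row_cons0; congr pair; apply/rowP => i.
  by rewrite mxE row_consS.
Qed.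

End Cardinality.

(** * Prime ideals *)

Section PrimeIdeals.
Variable O : comNzRingType.
Implicit Types (P I : set O) (x y : O).

Lemma prime0 P : nonzero_primes P -> P 0.
Proof. by case=> -[/set_mem]. Qed.

Lemma primeN1 P : nonzero_primes P -> ~ P 1.
Proof. by case=> -[_ + _] _ _ P1; rewrite mem_set. Qed.

Lemma prime_lin P a x y : nonzero_primes P -> P x -> P y -> P (a * x + y).
Proof. by case=> -[_ _ h] _ _ Px Py; apply/set_mem/h; exact: mem_set. Qed.

Lemma primeD P x y : nonzero_primes P -> P x -> P y -> P (x + y).
Proof. by move=> nP Px Py; rewrite -[x]mul1r; exact: prime_lin. Qed.

Lemma primeMr P a x : nonzero_primes P -> P x -> P (a * x).
Proof. by move=> nP Px; rewrite -[_ * _]addr0; apply: prime_lin => //; exact: prime0. Qed.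

Lemma primeMl P a x : nonzero_primes P -> P x -> P (x * a).
Proof. by rewrite mulrC; exact: primeMr. Qed.

Lemma primeN P x : nonzero_primes P -> P x -> P (- x).
Proof. by rewrite -mulN1r; exact: primeMr. Qed.

Lemma primeB P x y : nonzero_primes P -> P x -> P y -> P (x - y).
Proof. by move=> nP Px Py; apply: primeD => //; exact: primeN. Qed.

Lemma prime_sum P (I : Type) (r : seq I) (F : I -> O) :
  nonzero_primes P -> (forall i, P (F i)) -> P (\sum_(i <- r) F i).
Proof.
move=> nP PF; elim/big_ind : _ => [|x y|//]; [exact: prime0|exact: primeD].
Qed.

Lemma prime_mul P x y : nonzero_primes P -> P (x * y) -> P x \/ P y.
Proof.
case=> _ + _ Pxy => /(_ x y (mem_set Pxy)) /orP[] /set_mem; by [left|right].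
Qed.

Lemma prime_nz P : nonzero_primes P -> exists2 x, P x & x <> 0.
Proof.
move=> nP; have [_ _ /eqP nP0] := nP; apply: contrapT => h; apply: nP0.
apply/seteqP; split => x /=; last by move=> ->; exact: prime0.
by move=> Px; apply: contrapT => x0; apply: h; exists x.
Qed.

Lemma prime_ideal P : nonzero_primes P -> is_ideal P.
Proof.
by move=> nP; split; [exact: prime0|move=> x y; exact: primeD|move=> a x; exact: primeMr].
Qed.

Lemma prime_intro P : is_ideal P -> ~ P 1 ->
  (forall x y, P (x * y) -> P x \/ P y) -> (exists2 x, P x & x <> 0) ->
  nonzero_primes P.
Proof.
move=> [P0 PD PM] P1 Pp [x Px x0]; split.
- split; [exact: mem_set|by apply/negP => /set_mem|].
  by move=> a u v /set_mem Pu /set_mem Pv; apply/mem_set/PD => //; exact: PM.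
- by move=> u v /set_mem /Pp[] h; rewrite (mem_set h) ?orbT.
- by apply/eqP => P_0; apply: x0; rewrite P_0 in Px.
Qed.

(** This ideal is [I] + (x). It serves to enlarge an ideal in the argument by Zorn's lemma, and to
    form gcds in a principal ideal domain. *)
Lemma ideal_add I (x : O) : is_ideal I ->
  is_ideal [set z : O | exists a, exists2 y, I y & z = a * x + y].
Proof.
case=> I0 ID IM; split.
- by exists 0, 0 => //; rewrite mul0r addr0.
- move=> _ _ [a [y Iy ->]] [b [z Iz ->]]; exists (a + b), (y + z); first exact: ID.
  by ring.
- move=> c _ [a [y Iy ->]]; exists (c * a), (c * y); first exact: IM.
  by ring.
Qed.

Lemma principalP (a x : O) : principal a x <-> exists c, x = c * a.
Proof. by split=> [[c _ <-]|[c ->]]; exists c. Qed.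

Lemma ideal_principal (a : O) : is_ideal (principal a).
Proof.
split; first by apply/principalP; exists 0; rewrite mul0r.
- by move=> x y [b _ <-] [c _ <-]; apply/principalP; exists (b + c); ring.
- by move=> x y [b _ <-]; apply/principalP; exists (x * b); ring.
Qed.

Lemma gcd_ideal_is_ideal m (a : 'rV[O]_m) : is_ideal (gcd_ideal a).
Proof.
split=> [I [[I0 _ _] _] //|x y hx hy I hI|c x hx I hI].
- by have [[_ ID _] _] := hI; apply: ID; [exact: hx|exact: hy].
- by have [[_ _ IM] _] := hI; apply: IM; exact: hx.
Qed.

Lemma mem_gcd_ideal m (a : 'rV[O]_m) i : gcd_ideal a (a 0 i).
Proof. by move=> I [_]; apply; exists i => //; apply/principalP; exists 1; rewrite mul1r. Qed.

Lemma gcd_ideal_sub m (a : 'rV[O]_m) I :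
  is_ideal I -> (forall i, I (a 0 i)) -> gcd_ideal a `<=` I.
Proof.
move=> hI Ia x; apply; split => // y [i _ [c _ <-]].
by have [_ _ IM] := hI; exact: IM.
Qed.

Lemma visible_prime m (a b : 'rV[O]_m) P : visible a b -> nonzero_primes P ->
  ~ (forall i, P (a 0 i - b 0 i)).
Proof.
move=> vab nP Pab; apply: (primeN1 nP).
apply: (@gcd_ideal_sub _ (a - b) P); first exact: prime_ideal.
  by move=> i; rewrite !mxE.
by rewrite (vab : gcd_ideal _ = _).
Qed.

(** Zorn's lemma among proper ideals containing [I]. Maximality is expressed as invertibility modulo
    [J] of every element outside [J], the form in which it is used. *)
Lemma maximal_ideal_exists I : is_ideal I -> ~ I 1 ->
  exists J, [/\ is_ideal J, ~ J 1, I `<=` J &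
    forall x, ~ J x -> exists b, J (1 - b * x)].
Proof.
move=> hI I1.
pose good J := [/\ is_ideal J, ~ J 1 & I `<=` J].
have [F Fgood tF|M [MP Mmax]] := @Zorn_bigcup O (fun J => J = set0 \/ good J).
  have [[J FJ /eqP/set0P[x0 Jx0]]|h] := pselect (exists2 J, F J & J <> set0); last first.
    left; apply/seteqP; split => // x [J FJ Jx]; apply: h; exists J => // J0.
    by rewrite J0 in Jx.
  right.
  have gd K x : F K -> K x -> good K.
    by move=> FK Kx; case: (Fgood _ FK) => // K0; rewrite K0 in Kx.
  have [[J0 JD JM] J1 IJ] := gd _ _ FJ Jx0.
  split; last by move=> x /IJ Jx; exists J.
    split; first by exists J.
    - move=> x y [K FK Kx] [L FL Ly].
      have [[_ KD _] _ _] := gd _ _ FK Kx; have [[_ LD _] _ _] := gd _ _ FL Ly.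
      by case: (tF _ _ FK FL) => KL; [exists L => //; apply: LD => //; exact: KL
                                     |exists K => //; apply: KD => //; exact: KL].
    - move=> a x [K FK Kx]; exists K => //.
      by have [[_ _ KM] _ _] := gd _ _ FK Kx; exact: KM.
  move=> [K FK K1]; by have [_ + _] := gd _ _ FK K1.
have gM : good M.
  case: MP => // M0; exfalso; apply: (Mmax I); last by right; split.
  by rewrite M0; split => // h; have [I0 _ _] := hI; exact: (h 0).
have [[M0 MD MM] M1 IM] := gM; exists M; split => // x Mx.
set N := [set z | exists a, exists2 y, M y & z = a * x + y].
have hN : is_ideal N by exact: ideal_add.
have MN : M `<=` N by move=> y My; exists 0, y => //; rewrite mul0r add0r.
have Nx : N x by exists 1, 0 => //; rewrite mul1r addr0.
have : N 1.
  apply: contrapT => N1; apply: (Mmax N).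
    by split => // NM; apply: Mx; exact: NM.
  right; split => //; exact: subset_trans MN.
move=> [b [y My e]]; exists b; suff -> : 1 - b * x = y by [].
by rewrite e addrC addKr.
Qed.

(** A maximal ideal containing [I] is prime, and it is nonzero because [I] is. *)
Lemma prime_over I : is_ideal I -> ~ I 1 -> (exists2 x, I x & x <> 0) ->
  exists2 P, nonzero_primes P & I `<=` P.
Proof.
move=> hI I1 [x Ix x0]; have [J [hJ J1 IJ Jmax]] := maximal_ideal_exists hI I1.
exists J => //; apply: prime_intro => //; last by exists x => //; exact: IJ.
move=> u v Juv; have [Ju|/Jmax [b Jb]] := pselect (J u); [by left|right].
have [_ JD JM] := hJ.
have -> : v = v * (1 - b * u) + b * (u * v) by ring.
by apply: JD; exact: JM.
Qed.

(* The non-unit [d] provides a nonzero prime containing the zero ideal, which is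
   the gcd of two equal points. *)
Lemma visibleP m (a b : 'rV[O]_m) (d : O) : d <> 0 -> ~ principal d 1 ->
  (forall P, nonzero_primes P -> ~ (forall i, P (a 0 i - b 0 i))) -> visible a b.
Proof.
move=> d0 d1 h; apply: contrapT => nv.
have hg := gcd_ideal_is_ideal (a - b).
have g1 : ~ gcd_ideal (a - b) 1.
  move=> g1; apply: nv; apply/seteqP; split => // x _.
  by have [_ _ M] := hg; rewrite -[x]mulr1; exact: M.
suff [P nP gP] : exists2 P, nonzero_primes P & gcd_ideal (a - b) `<=` P.
  by apply: (h P nP) => i; have := gP _ (@mem_gcd_ideal _ (a - b) i); rewrite !mxE.
have [|z] := pselect (exists2 x, gcd_ideal (a - b) x & x <> 0); first exact: prime_over.
have [|P nP dP] := @prime_over (principal d) (ideal_principal d) d1.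
  by exists d => //; apply/principalP; exists 1; rewrite mul1r.
exists P => // x gx; suff -> : x = 0 by exact: prime0.
by apply: contrapT => x0; apply: z; exists x.
Qed.

Hypothesis PID : is_PID O.

Lemma mul_eq0_PID x y : x * y = 0 -> x = 0 \/ y = 0.
Proof. by case: PID => dom _ /dom /orP[] /eqP; [left|right]. Qed.

(** Write P = (q) and P + (x) = (d), so that q = e d. The prime P contains e or d: in the first case
    d is a unit and P + (x) is everything, in the second x lies in P. *)
Lemma prime_maximal P x : nonzero_primes P -> ~ P x -> exists b, P (1 - b * x).
Proof.
move=> nP Px; have [_ /(_ _ (prime_ideal nP)) [q Pq]] := PID.
have Pq' : P q by rewrite Pq; apply/principalP; exists 1; rewrite mul1r.
have [_ /(_ _ (ideal_add x (prime_ideal nP))) [d Nd]] := PID.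
have [e eqd] : exists e, q = e * d.
  by apply/principalP; rewrite -Nd; exists 0, q => //; rewrite mul0r add0r.
have [f exd] : exists f, x = f * d.
  by apply/principalP; rewrite -Nd; exists 1, 0; [exact: prime0|rewrite mul1r addr0].
have [||] := @prime_mul P e d nP; first by rewrite -eqd.
  rewrite {1}Pq => /principalP[g eg].
  have : q * (1 - g * d) = 0.
    have -> : q * (1 - g * d) = q - (g * q) * d by ring.
    by rewrite -eg -eqd subrr.
  case/mul_eq0_PID => [q0|gd1].
    (* A zero generator would make P the zero ideal. *)
    have [z Pz z0] := prime_nz nP; case: z0; move: Pz; rewrite Pq q0 => /principalP[c ->].
    by rewrite mulr0.
  have : principal d 1 by apply/principalP; exists g; apply/eqP; rewrite -subr_eq0 gd1.
  rewrite -Nd => -[b [y Py e1]]; exists b; suff -> : 1 - b * x = y by [].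
  by rewrite e1 addrC addKr.
by move=> Pd; case: Px; rewrite exd; exact: primeMr.
Qed.

(** Nonzero primes are maximal, so distinct ones are not contained in each other. An element of P'
    outside P, multiplied by its inverse modulo P, is the required [u]. *)
Lemma prime_separate P P' : nonzero_primes P -> nonzero_primes P' -> P <> P' ->
  exists2 u, P' u & P (1 - u).
Proof.
move=> nP nP' PP'; have [x P'x Px] : exists2 x, P' x & ~ P x.
  apply: contrapT => h; have P'P : P' `<=` P.
    by move=> x P'x; apply: contrapT => Px; apply: h; exists x.
  apply: PP'; apply/seteqP; split => // y Py; apply: contrapT => P'y.
  have [b /P'P Pb] := prime_maximal nP' P'y; apply: (primeN1 nP).
  by rewrite -[1](subrK (b * y)); apply: primeD => //; exact: primeMr.
have [b Pb] := prime_maximal nP Px; exists (b * x) => //; exact: primeMr.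
Qed.

(** Chinese remainder theorem in the form of an idempotent: the product of the elements separating P
    from each prime of the list. *)
Lemma prime_crt P (s : seq (set O)) : nonzero_primes P ->
  (forall P', P' \in s -> nonzero_primes P' /\ P <> P') ->
  exists2 u, (forall P', P' \in s -> P' u) & P (1 - u).
Proof.
move=> nP; elim: s => [_|P' s IH hs].
  by exists 1 => //; rewrite subrr; exact: prime0.
have [|u us Pu] := IH; first by move=> Q Qs; apply: hs; rewrite inE Qs orbT.
have [nP' PP'] := hs P' (mem_head _ _).
have [v P'v Pv] := prime_separate nP nP' PP'.
exists (u * v).
  move=> Q; rewrite inE => /orP[/eqP->|Qs]; first exact: primeMr.
  by apply: primeMl (us _ Qs); have [] := hs Q; rewrite ?inE ?Qs ?orbT.
have -> : 1 - u * v = (1 - u) + u * (1 - v) by ring.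
by apply: primeD => //; exact: primeMr.
Qed.

End PrimeIdeals.

(** * Coordinates, norms and residue classes *)

Lemma dvdn_dist_eq (p a b : nat) : (a < p)%N -> (b < p)%N ->
  (p %| absz (a%:Z - b%:Z))%N -> a = b.
Proof.
move=> ap bp; have [e0 _|/eqP ne /dvdn_leq] := pselect (absz (a%:Z - b%:Z) = 0%N); first by lia.
by lia.
Qed.

Section IntegralBasis.
Variables (O : comNzRingType) (n' : nat).
Local Notation n := n'.+1.
Variables (E : 'I_n -> O).
Hypothesis (hE : Zbasis E).
Implicit Types (P : set O) (x y : O).

Lemma combD (a b : 'rV[int]_n) : combination E (a + b) = combination E a + combination E b.
Proof. by rewrite /combination -big_split; apply: eq_bigr => i _; rewrite mxE mulrzDr. Qed.

Lemma combZ (k : int) (a : 'rV[int]_n) : combination E (k *: a) = combination E a *~ k.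
Proof.
by rewrite /combination mulrz_suml; apply: eq_bigr => i _; rewrite mxE mulrC mulrzA.
Qed.

Definition coord x : 'rV[int]_n := projT1 (cid (hE x)).

Lemma coordK x : combination E (coord x) = x.
Proof. by rewrite /coord; case: cid => a [/= <-]. Qed.

Lemma combK (a : 'rV[int]_n) : coord (combination E a) = a.
Proof. by rewrite /coord; case: cid => b [/= _]; apply. Qed.

Lemma coordD x y : coord (x + y) = coord x + coord y.
Proof. by rewrite -[RHS]combK combD !coordK. Qed.

Lemma coordZ x k : coord (x *~ k) = k *: coord x.
Proof. by rewrite -[RHS]combK combZ !coordK. Qed.

Lemma coord0 : coord 0 = 0.
Proof. by rewrite -(mulr0z (1 : O)) coordZ scale0r. Qed.

Lemma coordB x y : coord (x - y) = coord x - coord y.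
Proof. by rewrite coordD -mulrN1z coordZ scaleN1r. Qed.

Lemma coord_sum (I : Type) (r : seq I) (F : I -> O) :
  coord (\sum_(i <- r) F i) = \sum_(i <- r) coord (F i).
Proof. by elim/big_rec2: _ => [|i y1 y2 _ <-]; rewrite ?coord0 ?coordD. Qed.

Lemma combE i : combination E (delta_mx 0 i) = E i.
Proof.
rewrite /combination (bigD1 i)//= big1 ?addr0 => [|j /negbTE ji]; rewrite mxE eqxx /=.
  by rewrite eqxx.
by rewrite ji.
Qed.

Lemma coordE i : coord (E i) = delta_mx 0 i.
Proof. by rewrite -combE combK. Qed.

Lemma coord_inj x y : coord x = coord y -> x = y.
Proof. by move=> e; rewrite -(coordK x) e coordK. Qed.

(** If c p = 1, the first basis vector equals p times another element, and its first coordinate 1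
    would be divisible by p. *)
Lemma nat_nonunit (p : nat) : (1 < p)%N -> ~ principal (p%:R : O) 1.
Proof.
move=> p1 [c _ e].
have : coord (E ord0) = p%:Z *: coord (c * E ord0).
  by rewrite -coordZ -[LHS]/(coord (E ord0)) -{1}[E ord0]mul1r -e pmulrn mulrAC mulr_natr.
rewrite coordE => /rowP /(_ ord0); rewrite !mxE !eqxx /= => /esym e1.
have /dvdn_leq := dvdn_mulr (absz (coord (c * E ord0) ord0 ord0)) (dvdnn p).
by have := congr1 absz e1; rewrite abszM /= => ->; lia.
Qed.

Lemma nat_nonzero (p : nat) : (1 < p)%N -> (p%:R : O) <> 0.
Proof.
move=> p1 p0; have : coord (E ord0 *~ p%:Z) = coord 0.
  by rewrite -pmulrn -mulr_natr p0 mulr0.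
rewrite coordZ coordE coord0 => /rowP /(_ ord0); rewrite !mxE !eqxx /= mulr1.
by case=> e; rewrite e in p1.
Qed.

(** Multiplication by [x] in the basis, acting on row vectors from the right. Its determinant is the
    norm of [x], obtained here without embeddings of the field. *)
Definition mul_matrix x : 'M[int]_n := \matrix_(i, j) coord (x * E i) 0 j.
Definition abs_norm x : nat := `|\det (mul_matrix x)|%N.

Lemma comb_mul_matrix x (v : 'rV[int]_n) :
  combination E (v *m mul_matrix x) = combination E v * x.
Proof.
apply: coord_inj; rewrite combK /combination mulr_suml coord_sum.
apply/rowP => j; rewrite mxE summxE; apply: eq_bigr => i _.
by rewrite mulrzAl coordZ !mxE [E i * x]mulrC.
Qed.

(** The adjugate matrix, applied to the coordinates of 1, gives the cofactor that multiplies [x] to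
    its norm. *)
Lemma abs_norm_principal x : principal x (abs_norm x)%:R.
Proof.
suff [c e] : exists c, (\det (mul_matrix x))%:~R = c * x.
  rewrite /abs_norm; case: (ltrgtP 0 (\det (mul_matrix x))) => [d|d|d].
  - by apply/principalP; exists c; rewrite -e pmulrn gez0_abs// ltW.
  - by apply/principalP; exists (- c); rewrite mulNr -e pmulrn ltz0_abs// mulrNz.
  - by rewrite -d; apply/principalP; exists 0; rewrite mul0r.
exists (combination E (coord 1 *m \adj (mul_matrix x))).
by rewrite -comb_mul_matrix -mulmxA mul_adj_mx mul_mx_scalar combZ coordK.
Qed.

(** A nonzero vector in the kernel of the matrix would be a nonzero element annihilated by [x]. *)
Lemma abs_norm_gt0 x : GRing.integral_domain_axiom O -> x <> 0 -> (0 < abs_norm x)%N.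
Proof.
move=> dom x0; rewrite absz_gt0; apply/det0P => -[v /eqP v0 vM].
have : combination E v * x = 0.
  by rewrite -comb_mul_matrix vM -[RHS]coordK coord0.
by move=> /dom /orP[] /eqP // e; apply: v0; rewrite -(combK v) e coord0.
Qed.

Lemma prime_abs_norm P x : nonzero_primes P -> P x -> P (abs_norm x)%:R.
Proof. by move=> nP Px; have [c _ <-] := abs_norm_principal x; exact: primeMr. Qed.

(** Otherwise p and N are coprime and a Bezout relation puts 1 in P. *)
Lemma prime_dvd P (p N : nat) : nonzero_primes P -> prime p -> P p%:R -> P N%:R ->
  (p %| N)%N.
Proof.
move=> nP pp Pp PN; apply: contrapT => /negP; rewrite -prime_coprime// => cop.
have [[u v] /= e] : exists uv : nat * nat, (uv.1 * p = uv.2 * N + 1)%N.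
  have [u v e _] := @egcdnP p N (prime_gt0 pp); exists (u, v) => /=.
  by rewrite e (eqP cop).
apply: (primeN1 nP); have -> : 1 = u%:R * p%:R - v%:R * N%:R :> O.
  by rewrite -!natrM e natrD addrAC subrr add0r.
by apply: primeB => //; exact: primeMr.
Qed.

Lemma exists_prime_nat P N : nonzero_primes P -> (0 < N)%N -> P N%:R ->
  exists2 p, prime p & P p%:R.
Proof.
move=> nP; elim/ltn_ind: N => N IH N0 PN.
have N1 : (1 < N)%N.
  by case: N N0 PN {IH} => [|[|N]] // _ /(primeN1 nP).
have := PN; rewrite -{1}(divnK (pdiv_dvd N)) natrM => /(prime_mul nP)[PM|Pp].
  apply: (IH (N %/ pdiv N)%N) => //; first by apply: ltn_Pdiv => //; exact/prime_gt1/pdiv_prime.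
  by rewrite divn_gt0 ?pdiv_gt0// dvdn_leq// pdiv_dvd.
by exists (pdiv N) => //; exact: pdiv_prime.
Qed.

Lemma prime_over_nat P : GRing.integral_domain_axiom O -> nonzero_primes P ->
  exists2 p, prime p & P p%:R.
Proof.
move=> dom nP; have [x Px x0] := prime_nz nP.
apply: (@exists_prime_nat _ (abs_norm x)) => //; first exact: abs_norm_gt0.
exact: prime_abs_norm.
Qed.

(** The norm is a homogeneous form of degree [n] in the coordinates. Each matrix entry is at most
    [D] B, where [D] sums the absolute values of all structure constants, and the determinant has n!
    terms. *)
Lemma abs_norm_bound : exists C : nat, forall x (B : nat),
  (forall i, (absz (coord x 0%R i) <= B)%N) -> (abs_norm x <= C * B ^ n)%N.
Proof.
pose D := (\sum_i \sum_k \sum_j absz (coord (E k * E i) 0%R j))%N.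
exists (n`! * D ^ n)%N => x B hB.
have entry i j : (absz (mul_matrix x i j) <= D * B)%N.
  have -> : mul_matrix x i j = \sum_k coord x 0 k * coord (E k * E i) 0 j.
    rewrite mxE -{1}(coordK x) /combination mulr_suml coord_sum summxE.
    by apply: eq_bigr => k _; rewrite mulrzAl coordZ mxE.
  rewrite -lez_nat abszE (le_trans (ler_norm_sum _ _ _))//.
  apply: (@le_trans _ _ (\sum_k (B * absz (coord (E k * E i) 0%R j))%N%:Z)).
    by apply: ler_sum => k _; rewrite normrM PoszM ler_wpM2r//= -abszE lez_nat.
  under eq_bigr do rewrite -natz.
  rewrite -natr_sum natz lez_nat -big_distrr/= mulnC leq_mul2r; apply/orP; right.
  apply: (@leq_trans (\sum_k \sum_j absz (coord (E k * E i) 0%R j))%N).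
    by apply: leq_sum => k _; rewrite (bigD1 j)//= leq_addr.
  by rewrite /D [leqRHS](bigD1 i)//= leq_addr.
rewrite -mulnA -expnMn /abs_norm -lez_nat abszE /determinant (le_trans (ler_norm_sum _ _ _))//.
apply: (@le_trans _ _ (\sum_(s : 'S_n) ((D * B) ^ n)%N%:Z)).
  apply: ler_sum => s _; rewrite normrM normr_sign mul1r normr_prod.
  rewrite -[in leRHS](card_ord n) -prod_nat_const -natz natr_prod.
  by under [leRHS]eq_bigr do rewrite natz; apply: ler_prod => i _; rewrite normr_ge0 /= -abszE lez_nat.
by rewrite sumr_const card_Sn pmulrn -mulrzr intz PoszM mulrC.
Qed.

(** The quotient of O by Q O is modelled by the coordinate vectors modulo Q. What is recorded of it
    is its cardinality, the reduction map and a section. *)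
Lemma residues (Q : nat) : (0 < Q)%N ->
  exists (G : finType) (red : O -> G) (lft : G -> O),
  [/\ #|G| = (Q ^ n)%N, forall g, red (lft g) = g &
      forall x y, red x = red y <-> exists w, x - y = w *+ Q].
Proof.
case: Q => // q _; exists 'rV['I_q.+1]_n.
exists (fun x => map_mx (fun z => inord `|(z %% q.+1)%Z|%N) (coord x)).
exists (fun g => combination E (map_mx (fun i : 'I_q.+1 => (i : nat)%:Z) g)).
split; first by rewrite card_mx card_ord mul1n.
  move=> g; rewrite combK; apply/rowP => i; rewrite !mxE modz_nat /= modn_small//.
  by rewrite inord_val.
move=> x y; split.
  move=> /rowP e.
  have e2 i : exists k, coord x 0 i - coord y 0 i = k * q.+1%:Z.
    have := e i; rewrite !mxE => /(congr1 (@nat_of_ord _)).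
    rewrite !inordK; [|lia|lia] => e1.
    apply/dvdzP; rewrite -eqz_mod_dvd; apply/eqP; lia.
  pose k := \row_i projT1 (cid (e2 i)); exists (combination E k).
  apply: coord_inj; rewrite coordB pmulrn coordZ combK; apply/rowP => i.
  by rewrite !mxE; case: cid => z /= ->; rewrite mulrC.
move=> [w e]; have -> : x = y + w *+ q.+1 by rewrite -e addrC subrK.
apply/rowP => i; rewrite !mxE coordD pmulrn coordZ !mxE; congr inord.
by rewrite addrC mulrC modzMDl.
Qed.

Lemma cubeP L x : cube_lattice E L x <-> forall i, (absz (coord x 0%R i) <= L)%N.
Proof.
split=> [[a /= aL <-] i|xL].
  by rewrite combK -lez_nat abszE ler_norml; exact: aL.
exists (coord x); last exact: coordK.
by move=> i /=; rewrite -ler_norml -abszE lez_nat.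
Qed.

Definition residue_class P (c : O) : set O := [set y | P (y - c)].

(** Translates the interval [-L, L] onto {0, ..., 2 L}, so that points of a cube can be counted by a
    finite type. *)
Definition shift_coord (L : nat) (k : int) : 'I_(2 * L).+1 := inord (absz (k + L%:Z)).

Lemma shift_coord_inj L (k l : int) : (absz k <= L)%N -> (absz l <= L)%N ->
  shift_coord L k = shift_coord L l -> k = l.
Proof.
by move=> kL lL /(congr1 (@nat_of_ord _)); rewrite !inordK; [lia|lia|lia].
Qed.

Lemma cube_finite L : finite_set (cube_lattice E L).
Proof.
apply: (@finite_inj _ 'rV['I_(2 * L).+1]_n _ setT (fun x => map_mx (shift_coord L) (coord x))) => //.
  exact: finite_finset.
move=> x y /cubeP xL /cubeP yL /rowP e; apply: coord_inj; apply/rowP => i.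
by have := e i; rewrite !mxE; exact: shift_coord_inj.
Qed.

Lemma cube_card L : (card (cube_lattice E L) <= (2 * L).+1 ^ n)%N.
Proof.
rewrite -[X in (_ <= X ^ n)%N]card_ord -[n in (_ <= _ ^ n)%N]mul1n -card_mx.
apply: (leq_card_finType (f := fun x => map_mx (shift_coord L) (coord x))).
move=> x y /cubeP xL /cubeP yL /rowP e; apply: coord_inj; apply/rowP => i.
by have := e i; rewrite !mxE; exact: shift_coord_inj.
Qed.

Lemma prime_absz P (z : int) : nonzero_primes P -> P z%:~R -> P (absz z)%:R.
Proof.
move=> nP; case: (lerP 0 z) => z0 Pz; first by rewrite pmulrn gez0_abs.
by rewrite pmulrn ltz0_abs// mulrNz; exact: primeN.
Qed.

(** A prime containing the whole basis would contain 1. *)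
Lemma prime_notin_basis P : nonzero_primes P -> exists i, ~ P (E i).
Proof.
move=> nP; apply: contrapT => h; apply: (primeN1 nP); rewrite -(coordK 1).
apply: prime_sum => // i; rewrite -mulrzl; apply: primeMr => //.
by apply: contrapT => Pi; apply: h; exists i.
Qed.

(* Inside a coset of [P], some coordinate is determined modulo [p] by the
   other ones. *)
Lemma coset_card P (p : nat) (c : O) (L : nat) : nonzero_primes P -> prime p -> P p%:R ->
  (card (cube_lattice E L `&` residue_class P c) <=
   ((2 * L) %/ p).+1 * (2 * L).+1 ^ n')%N.
Proof.
move=> nP pp Pp; have [i0 Pi0] := prime_notin_basis nP.
pose g (k : int) : nat := absz (k + L%:Z).
(* Of the coordinate [i0] only the quotient by p, after translation by L, is recorded; the other
   coordinates are recorded in full. *)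
pose f y : 'I_((2 * L) %/ p).+1 * 'rV['I_(2 * L).+1]_n' :=
  (inord (g (coord y 0%R i0) %/ p)%N,
   \row_j shift_coord L (coord y 0 (lift i0 j))).
rewrite -[X in (_ <= X * _)%N]card_ord -[X in (_ <= _ * X ^ _)%N]card_ord.
rewrite -[n' in (_ <= _ * _ ^ n')%N]mul1n -card_mx -card_prod.
apply: (leq_card_finType (f := f)) => x y [/cubeP xL Px] [/cubeP yL Py] [e1 /rowP e2].
have off j : coord x 0 (lift i0 j) = coord y 0 (lift i0 j).
  by have := e2 j; rewrite !mxE; exact: shift_coord_inj.
have xy : x - y = (coord x 0 i0 - coord y 0 i0)%:~R * E i0.
  apply: coord_inj; rewrite mulrzl coordZ coordE coordB; apply/rowP => j.
  rewrite !mxE; case: (unliftP i0 j) => [k ->|->]; last by rewrite !eqxx mulr1.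
  by rewrite off subrr eq_sym (negbTE (neq_lift _ _)) andbF mulr0.
(* The difference is an integer multiple of [E i0], which lies outside the prime P. Hence P contains
   that integer, and p divides it. *)
have : P (x - y).
  by rewrite (_ : x - y = (x - c) - (y - c)); [exact: primeB|ring].
rewrite xy => /(prime_mul nP)[|//] /(prime_absz nP) /(prime_dvd nP pp Pp) pd.
have i0L := xL i0; have i0L' := yL i0.
have bnd (k : int) : (absz k <= L)%N -> (g k %/ p < ((2 * L) %/ p).+1)%N.
  by move=> kL; rewrite ltnS leq_div2r// /g; lia.
have {e1} : (g (coord x 0%R i0) %/ p = g (coord y 0%R i0) %/ p)%N.
  by move/(congr1 (@nat_of_ord _)): e1; rewrite /= !inordK ?bnd.
move=> e1; suff e : coord x 0 i0 = coord y 0 i0.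
  by apply/eqP; rewrite -subr_eq0 xy e subrr mul0r.
have : (g (coord x 0%R i0) = g (coord y 0%R i0) %[mod p])%N.
  have gx : (g (coord x 0%R i0))%:Z = coord x 0 i0 + L%:Z by rewrite /g; lia.
  have gy : (g (coord y 0%R i0))%:Z = coord y 0 i0 + L%:Z by rewrite /g; lia.
  apply/eqP; case: (leqP (g (coord y 0%R i0)) (g (coord x 0%R i0))) => [le|/ltnW le].
    by rewrite eqn_mod_dvd//; congr (p %| _)%N: pd; lia.
  by rewrite eq_sym eqn_mod_dvd//; congr (p %| _)%N: pd; lia.
move=> e3; have := divn_eq (g (coord x 0%R i0)) p.
rewrite e1 e3 -divn_eq /g; lia.
Qed.

(** If k distinct primes contain p, the combinations of their k idempotents with coefficients in {0,
    ..., p - 1} are distinct modulo p O. This quotient has p^n elements, so p^k <= p^n. *)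
Lemma primes_above (p : nat) (s : seq (set O)) : is_PID O -> prime p -> uniq s ->
  (forall P, P \in s -> nonzero_primes P /\ P p%:R) -> (size s <= n)%N.
Proof.
move=> PID pp us hs; set k := size s.
have p0 := prime_gt0 pp.
have [G [red [lft [cG _ redE]]]] := residues p0.
pose Q (i : 'I_k) := nth set0 s i.
have Qs i : Q i \in s by exact: mem_nth.
have crt i : exists u, (forall P', P' \in rem (Q i) s -> P' u) /\ Q i (1 - u).
  have [|u h1 h2] := @prime_crt _ PID (Q i) (rem (Q i) s) (hs _ (Qs i)).1; last by exists u.
  move=> P'; rewrite mem_rem_uniq// !inE => /andP[/eqP ne /hs[? _]]; split => //.
  by move=> e; apply: ne.
pose e i := projT1 (cid (crt i)).
have eQ i : Q i (1 - e i) by rewrite /e; case: cid => u [].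
have eQ' i j : j != i -> Q j (e i).
  move=> ji; rewrite /e; case: cid => u [/= h _]; apply: h.
  by rewrite mem_rem_uniq// !inE nth_uniq// Qs andbT.
pose f (v : {ffun 'I_k -> 'I_p}) : G := red (\sum_i (v i)%:R * e i).
suff /leq_card : injective f.
  by rewrite card_ffun !card_ord cG leq_exp2l// prime_gt1.
move=> v w /redE [z ez]; apply/ffunP => j; have [nQ Qp] := hs _ (Qs j).
have Qd : Q j ((v j)%:R - (w j)%:R).
  (* Modulo [Q j] the element [e j] is 1 and the other [e i] vanish, so the difference of the two
     combinations, a multiple of p, reduces to v j - w j. *)
  have -> : (v j)%:R - (w j)%:R = ((v j)%:R - (w j)%:R) * (1 - e j) + (p%:R * z -
     \sum_(i | i != j) ((v i)%:R - (w i)%:R) * e i) :> O.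
    rewrite mulr_natl -ez -sumrB.
    under eq_bigr do rewrite -mulrBl.
    by rewrite (bigD1 j)//= addrK; ring.
  apply: primeD => //; first exact: primeMr.
  apply: primeB => //; first exact: primeMl.
  rewrite big_mkcond; apply: prime_sum => // i; case: ifP => ij; last exact: prime0.
  by apply: primeMr => //; apply: eQ'; rewrite eq_sym.
have : Q j ((v j)%:Z - (w j)%:Z)%:~R by rewrite mulrzBr -!pmulrn.
move=> /(prime_absz nQ) /(prime_dvd nQ pp Qp) pd; apply/val_inj => /=.
exact: dvdn_dist_eq (ltn_ord _) (ltn_ord _) pd.
Qed.

End IntegralBasis.

(** * Euler products and periodic sets *)

Section Cosets.
Variable O : comNzRingType.
Implicit Types (P : set O) (x y : O).

Definition coset P x : set O := [set x + y | y in P].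

Lemma cosetP P x y : nonzero_primes P -> coset P x = coset P y <-> P (x - y).
Proof.
move=> nP; split=> [e|Pxy].
  have : coset P x x by exists 0; [exact: prime0|rewrite addr0].
  by rewrite e => -[z Pz <-]; rewrite addrC addKr.
apply/seteqP; split=> _ [z Pz <-].
  by exists (x - y + z); [exact: primeD|ring].
exists (z - (x - y)); [exact: primeB|ring].
Qed.

Lemma ideal_norm_infinite P : infinite_set (range (coset P)) -> ideal_norm P = 0%N.
Proof.
move=> h; rewrite /ideal_norm /card /fset_set; case: pselect => //.
Qed.

(** No nonzero prime contains all coordinates of the difference of two distinct points of [S], so
    reduction modulo P is injective on [S]. *)
Lemma admissible_norm m (S : {fset 'rV[O]_m}) P : admissible S -> nonzero_primes P ->
  finite_set (range (coset P)) -> (#|` S| <= ideal_norm P ^ m)%N.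
Proof.
move=> adm nP fin; have [fX cX] := card_rows (fun _ : 'I_m => fin).
rewrite prod_nat_const card_ord in cX; rewrite -cX.
have -> : #|` S| = card [set` S] by rewrite /card set_fsetK.
apply: (leq_card_inj (f := map_mx (coset P))) => //.
  by move=> a _ i; rewrite mxE; exists (a 0 i).
move=> a b /= aS bS /rowP e; apply: contrapT => /eqP ab.
apply: (visible_prime (adm _ _ aS bS ab) nP) => i.
by apply/cosetP => //; have := e i; rewrite !mxE.
Qed.

Lemma euler_factor_bounds (R : realType) m (S : {fset 'rV[O]_m}) P : (0 < m)%N ->
  admissible S -> nonzero_primes P -> 0 <= euler_factor R m #|` S| P <= 1.
Proof.
move=> m0 adm nP; rewrite /euler_factor.
(* For an infinite quotient the norm is 0 by convention; since m > 0 and the inverse of 0 is 0, the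
   factor is then 1. *)
have [fin|/ideal_norm_infinite ->] := pselect (finite_set (range (coset P))); last first.
  by rewrite expr0n gtn_eqF// invr0 mulr0 subr0 ler01 lexx.
rewrite subr_ge0 lerBlDr lerDl mulr_ge0 ?invr_ge0 ?exprn_ge0// andbT.
have sN := admissible_norm adm nP fin.
have [->|N0] := posnP (ideal_norm P).
  by rewrite expr0n gtn_eqF// invr0 mulr0 ler01.
by rewrite ler_pdivrMr ?exprn_gt0 ?ltr0n// mul1r -natrX ler_nat.
Qed.

End Cosets.

#[local] Existing Instance totally_filter.

(** * Unordered products of factors in [0, 1] *)

Section MonotoneProducts.
Variables (R : realType) (I : choiceType) (D : set I) (f : I -> R).
Hypothesis f01 : forall i, D i -> 0 <= f i <= 1.

Lemma partial_prod_bounds A : 0 <= partial_prod D f A <= 1.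
Proof.
rewrite /partial_prod; elim/big_ind: _ => [|x y|i /set_mem]; rewrite ?ler01 ?lexx//; last exact: f01.
by move=> /andP[x0 x1] /andP[y0 y1]; rewrite mulr_ge0//= mulr_ile1.
Qed.

Lemma partial_prod_le (A B : {fset I}) : (A `<=` B)%fset ->
  partial_prod D f B <= partial_prod D f A.
Proof.
move=> AB; rewrite {1}/partial_prod big_mkcond (big_fsetID _ (mem A))/=.
have -> : [fset x in B | x \in A]%fset = A.
  apply/fsetP => x; rewrite !inE /= andbC; case: (boolP (x \in A)) => //= xA.
  exact: (fsubsetP AB).
rewrite -!big_mkcond/=.
have /andP[p0 _] := partial_prod_bounds A.
have /andP[q0 q1] := partial_prod_bounds [fset x in B | x \notin A]%fset.
by rewrite -/(partial_prod D f A) -[leRHS]mulr1 ler_wpM2l.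
Qed.

(** The partial products decrease along inclusion and are bounded below by 0, so they converge to
    their infimum. *)
Lemma partial_prod_cvg :
  partial_prod D f @ totally --> inf (range (partial_prod D f)).
Proof.
have hi : has_inf (range (partial_prod D f)).
  split; first by exists (partial_prod D f fset0), fset0.
  by exists 0 => _ [A _ <-]; have /andP[] := partial_prod_bounds A.
apply/cvgrPdist_lt => e e0.
have [_ [A _ <-] lA] := inf_adherent e0 hi.
exists A => // B /= AB; rewrite distrC ger0_norm ?subr_ge0.
  by rewrite ltrBlDr addrC; apply: le_lt_trans lA; exact: partial_prod_le.
by apply: ge_inf; [exact: hi.2|exists B].
Qed.

Lemma infinite_prodE : infinite_prod D f = inf (range (partial_prod D f)).
Proof. by apply: cvg_lim => //; exact: partial_prod_cvg. Qed.

Lemma infinite_prod_le A : infinite_prod D f <= partial_prod D f A.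
Proof.
rewrite infinite_prodE; apply: ge_inf; last by exists A.
by exists 0 => _ [B _ <-]; have /andP[] := partial_prod_bounds B.
Qed.

Lemma infinite_prod_approx e : 0 < e ->
  exists A, partial_prod D f A < infinite_prod D f + e.
Proof.
move=> e0; rewrite infinite_prodE.
have hi : has_inf (range (partial_prod D f)).
  split; first by exists (partial_prod D f fset0), fset0.
  by exists 0 => _ [A _ <-]; have /andP[] := partial_prod_bounds A.
by have [_ [A _ <-] lA] := inf_adherent e0 hi; exists A.
Qed.

End MonotoneProducts.

(** * Counting residue classes modulo Q *)

Section PeriodicCount.
Variables (R : realType) (O : comNzRingType) (m Q : nat).
Variables (G : finType) (red : O -> G) (lft : G -> O).
Hypothesis PID : is_PID O.
Hypothesis lftK : forall g, red (lft g) = g.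
Hypothesis redP : forall x y, red x = red y <-> exists w, x - y = w *+ Q.

Definition periodic (T : set 'rV[O]_m) :=
  forall z z' : 'rV[O]_m,
    (forall i, exists w, z 0 i - z' 0 i = w *+ Q) -> T z -> T z'.

(** For a periodic set this is the number of classes modulo Q that it contains, tested on the
    representatives given by [lft]. *)
Definition class_count (T : set 'rV[O]_m) : nat :=
  card [set g : 'rV[G]_m | T (map_mx lft g)].

Lemma periodic_red T z z' : periodic T -> map_mx red z = map_mx red z' -> T z -> T z'.
Proof.
move=> pT /rowP e; apply: pT => i.
by have := e i; rewrite !mxE => /redP.
Qed.

(** Translation by [v] permutes the classes modulo Q. As [lft] is not additive, the translate is
    reduced again, and periodicity absorbs the change of representative. *)
Lemma class_count_shift T T' v : periodic T -> periodic T' ->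
  (forall z, T z <-> T' (z + v)) -> class_count T = class_count T'.
Proof.
move=> pT pT' h; pose sh v (g : 'rV[G]_m) := map_mx red (map_mx lft g + v).
have shK w : cancel (sh w) (sh (- w)).
  move=> g; apply/rowP => i; rewrite !mxE -[RHS]lftK; apply/redP.
  have [w' e] : exists w', lft (red (lft (g 0 i) + w 0 i)) - (lft (g 0 i) + w 0 i) = w' *+ Q.
    by apply/redP; rewrite lftK.
  by exists w'; rewrite -e; ring.
have shP w T1 T2 : periodic T2 -> (forall z, T1 z -> T2 (z + w)) ->
    (class_count T1 <= class_count T2)%N.
  move=> p2 hw; apply: (leq_card_inj (f := sh w)); first exact: finite_finset.
    move=> g /hw; apply: (periodic_red p2).
    by apply/rowP => i; rewrite !mxE lftK.
  by move=> g g' _ _; exact: (can_inj (shK w)).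
apply/eqP; rewrite eqn_leq (shP v)//=; last by move=> z /h.
by apply: (shP (- v)) => // z T'z; apply/h; rewrite subrK.
Qed.

Variable S : {fset 'rV[O]_m}.
Hypothesis adm : admissible S.

(** The approximation of V(S) that keeps only the conditions at the listed primes. *)
Definition avoid (Ps : seq (set O)) : set 'rV[O]_m :=
  [set z | forall P x, P \in Ps -> x \in S -> ~ (forall i, P (z 0 i - x 0 i))].

Definition congruent P (y : 'rV[O]_m) : set 'rV[O]_m :=
  [set z | forall i, P (z 0 i - y 0 i)].

(** When P contains Q, a congruence modulo P depends only on the classes modulo Q. *)
Definition good_prime (P : set O) := nonzero_primes P /\ P Q%:R.

Lemma good_prime_mult P (w : O) : good_prime P -> P (w *+ Q).
Proof. by case=> nP PQ; rewrite -mulr_natr; exact: primeMr. Qed.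

Lemma periodic_congruent P y : good_prime P -> periodic (congruent P y).
Proof.
move=> gP z z' zz' zy i; have [w e] := zz' i; have [nP _] := gP.
have -> : z' 0 i - y 0 i = (z 0 i - y 0 i) - w *+ Q by rewrite -e; ring.
by apply: primeB => //; exact: good_prime_mult.
Qed.

Lemma periodic_setI T T' : periodic T -> periodic T' -> periodic (T `&` T').
Proof. by move=> pT pT' z z' zz' [? ?]; split; [exact: pT zz' _|exact: pT' zz' _]. Qed.

Lemma periodic_avoid Ps : (forall P, P \in Ps -> good_prime P) -> periodic (avoid Ps).
Proof.
move=> gPs z z' zz' zA P x Pin xS zx; apply: (zA P x Pin xS).
apply: (@periodic_congruent P x _ z' z) => //; first exact: gPs.
by move=> i; have [w e] := zz' i; exists (- w); rewrite mulNrn -e opprB.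
Qed.

Lemma finite_cosets P : good_prime P -> finite_set (range (coset P)).
Proof.
move=> gP; have [nP _] := gP.
apply: (@sub_finite_set _ _ ((coset P \o lft) @` setT)); last first.
  exact/finite_image/finite_finset.
move=> _ [x _ <-]; exists (red x) => //=; apply/cosetP => //.
have [w ->] : exists w, lft (red x) - x = w *+ Q by apply/redP; rewrite lftK.
exact: good_prime_mult.
Qed.

Lemma ideal_norm_gt0 P : good_prime P -> (0 < ideal_norm P)%N.
Proof.
move=> gP; apply: (@leq_trans (card [set coset P 0])).
  by rewrite /card fset_set1 cardfs1.
apply: card_sub; first exact: finite_cosets.
by move=> _ ->; exists 0.
Qed.

(** Reduction modulo P partitions [T] into N(P)^m parts, all of the same size by assumption. *)
Lemma class_count_congruent P T : good_prime P -> periodic T ->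
  (forall y y', class_count (T `&` congruent P y) = class_count (T `&` congruent P y')) ->
  forall y, class_count T = (ideal_norm P ^ m * class_count (T `&` congruent P y))%N.
Proof.
move=> gP pT cst y; have [nP _] := gP.
have [fX cX] := card_rows (fun _ : 'I_m => finite_cosets gP).
rewrite prod_nat_const card_ord in cX.
set X := [set a : 'rV[set O]_m | _] in fX cX.
pose k (g : 'rV[G]_m) := map_mx (coset P) (map_mx lft g).
rewrite {1}/class_count.
have -> : [set g : 'rV[G]_m | T (map_mx lft g)] =
    \bigcup_(a in [set` fset_set X]) [set g | T (map_mx lft g) /\ k g = a].
  apply/seteqP; split => [g Tg|g [a _ []//]]; exists (k g) => //=.
  rewrite in_fset_set//; apply/mem_set => i; rewrite !mxE.
  by exists (lft (g 0 i)).
rewrite card_bigcup ?fset_uniq//; last 2 first.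
- by move=> a; exact: finite_finset.
- by move=> a b g _ _ [_ <-] [_ <-].
rewrite -[ideal_norm P]/(card _) -cX mulnC -iter_addn_0 {2}/card.
rewrite -(count_predT (fset_set X)) -(big_const_seq _ _ _ predT).
rewrite big_seq [RHS]big_seq; apply: eq_bigr => a; rewrite in_fset_set// => /set_mem Xa.
have ya i : exists x, coset P x = a 0 i by have [x _ <-] := Xa i; exists x.
pose y' : 'rV[O]_m := \row_i projT1 (cid (ya i)).
rewrite (cst y y'); congr card; apply/seteqP; split => g /= [Tg].
  move=> /rowP e; split => // i; apply/cosetP => //.
  by have := e i; rewrite !mxE => ->; case: cid.
move=> gy; split => //; apply/rowP => i; rewrite !mxE.
by have /cosetP -/(_ nP) := gy i; rewrite !mxE => ->; case: cid.
Qed.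

(* Translating by a multiple of a CRT idempotent moves the class modulo [P]
   without touching the conditions modulo the other primes. *)
Lemma class_count_avoid Ps : uniq Ps -> (forall P, P \in Ps -> good_prime P) ->
  (class_count (avoid Ps))%:R =
  (class_count setT)%:R * \prod_(P <- Ps) euler_factor R m #|` S| P :> R.
Proof.
elim: Ps => [_ _|P s IH /= /andP[Ps us] gPs].
  by rewrite big_nil mulr1; congr (card _)%:R; apply/seteqP; split.
have gP : good_prime P by apply: gPs; exact: mem_head.
have gs P' : P' \in s -> good_prime P' by move=> h; apply: gPs; rewrite inE h orbT.
have [nP PQ] := gP; have pA := periodic_avoid gs.
have [|u us' Pu] := @prime_crt _ PID P s nP.
  by move=> P' h; have [? _] := gs _ h; split => // e; move: Ps; rewrite e h.
have cst y y' : class_count (avoid s `&` congruent P y) =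
                class_count (avoid s `&` congruent P y').
  apply: (@class_count_shift _ _ (\row_i (u * (y' 0 i - y 0 i)))).
  - by apply: periodic_setI => //; exact: periodic_congruent.
  - by apply: periodic_setI => //; exact: periodic_congruent.
  move=> z; split=> -[zA zy]; split.
  - move=> P' x P'in xS zx; apply: (zA _ _ P'in xS) => i.
    have [nP' _] := gs _ P'in; have := zx i; rewrite !mxE => h.
    have -> : z 0 i - x 0 i = (z 0 i + u * (y' 0 i - y 0 i) - x 0 i) - u * (y' 0 i - y 0 i).
      by ring.
    by apply: primeB => //; apply: primeMl => //; exact: us'.
  - move=> i; have h := zy i; rewrite !mxE.
    have -> : z 0 i + u * (y' 0 i - y 0 i) - y' 0 i =
      (z 0 i - y 0 i) - (1 - u) * (y' 0 i - y 0 i) by ring.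
    by apply: primeB => //; exact: primeMl.
  - move=> P' x P'in xS zx; apply: (zA _ _ P'in xS) => i.
    have [nP' _] := gs _ P'in; have := zx i; rewrite !mxE => h.
    have -> : z 0 i + u * (y' 0 i - y 0 i) - x 0 i = (z 0 i - x 0 i) + u * (y' 0 i - y 0 i).
      by ring.
    by apply: primeD => //; apply: primeMl => //; exact: us'.
  - move=> i; have := zy i; rewrite !mxE => h.
    have -> : z 0 i - y 0 i =
      (z 0 i + u * (y' 0 i - y 0 i) - y' 0 i) + (1 - u) * (y' 0 i - y 0 i) by ring.
    by apply: primeD => //; exact: primeMl.
pose c := class_count (avoid s `&` congruent P 0).
have cT : class_count (avoid s) = (ideal_norm P ^ m * c)%N.
  exact: class_count_congruent.
(* The classes lost when P is added are those congruent modulo P to some point of [S]. Admissibility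
   makes these |S| families disjoint, and each has c elements. *)
have cS : class_count (avoid s) = (class_count (avoid (P :: s)) + #|` S| * c)%N.
  rewrite {1}/class_count.
  have -> : [set g : 'rV[G]_m | avoid s (map_mx lft g)] =
      [set g | avoid (P :: s) (map_mx lft g)] `|`
      \bigcup_(x in [set` S]) [set g | (avoid s `&` congruent P x) (map_mx lft g)].
    apply/seteqP; split => g /=.
      move=> gA; have [[x xS gx]|h] := pselect (exists2 x, x \in S & congruent P x (map_mx lft g)).
        by right; exists x.
      left => P' x; rewrite inE => /orP[/eqP -> xS gx|]; last exact: gA.
      by apply: h; exists x.
    case=> [gA P' x P'in|[x _ []//]]; apply: gA; by rewrite inE P'in orbT.
  rewrite card_setU; [|exact: finite_finset|exact: finite_finset|]; last first.
    apply/seteqP; split => // g /= [gA [x xS [_ gx]]].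
    exact: (gA P x (mem_head _ _) xS).
  congr addn; rewrite card_bigcup ?fset_uniq//; last 2 first.
  - by move=> a; exact: finite_finset.
  - move=> x y g xS yS /= [_ gx] [_ gy]; apply: contrapT => /eqP xy.
    apply: (visible_prime (adm xS yS xy) nP) => i.
    rewrite (_ : x 0 i - y 0 i = (map_mx lft g 0 i - y 0 i) - (map_mx lft g 0 i - x 0 i)); last by ring.
    exact: primeB nP (gy i) (gx i).
  rewrite mulnC -iter_addn_0 -(count_predT S) -(big_const_seq _ _ _ predT).
  by apply: eq_bigr => x _; exact: cst.
rewrite big_cons mulrCA -IH// /euler_factor.
have N0 : (ideal_norm P)%:R ^+ m != 0 :> R.
  by rewrite expf_neq0// pnatr_eq0 -lt0n ideal_norm_gt0.
have -> : (class_count (avoid (P :: s)))%:R =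
  (class_count (avoid s))%:R - #|` S|%:R * c%:R :> R by rewrite cS natrD natrM addrK.
by rewrite cT natrM natrX; field.
Qed.

End PeriodicCount.

(** * The contribution of the large primes *)

(** Telescoping, from (a + 1)^-2 <= a^-1 - (a + 1)^-1. *)
Lemma sum_inv_square (R : realFieldType) (M N : nat) : (0 < M)%N -> (M <= N)%N ->
  \sum_(M.+1 <= q < N.+1) (q%:R ^- 2) <= M%:R^-1 - N%:R^-1 :> R.
Proof.
move=> M0; elim: N => [|N IH] MN; first by move: M0; rewrite ltnNge MN.
move: MN; rewrite leq_eqVlt => /orP[/eqP <-|]; first by rewrite big_geq// subrr.
rewrite ltnS => MN; rewrite big_nat_recr//=; apply: (le_trans (lerD (IH MN) (lexx _))).
have N0 : 0 < N%:R :> R by rewrite ltr0n; exact: leq_trans MN.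
set a : R := N%:R in N0 *; have -> : N.+1%:R = a + 1 :> R by rewrite -natr1.
suff : (a + 1) ^- 2 <= a^-1 - (a + 1)^-1 by lra.
rewrite -subr_ge0; have -> : a^-1 - (a + 1)^-1 - (a + 1) ^- 2 = (a * (a + 1) ^+ 2)^-1.
  by field; rewrite !gt_eqF// addr_gt0.
by rewrite invr_ge0 mulr_ge0 ?exprn_ge0 ?addr_ge0// ltW.
Qed.

(** The product of these primes divides N, and each of them exceeds T. *)
Lemma large_primes_count (N T : nat) : (0 < N)%N ->
  (T ^ size [seq q <- primes N | (T < q)%N] <= N)%N.
Proof.
move=> N0; rewrite size_filter -iter_muln_1 -(big_const_seq _ _ _ (fun q => T < q)%N).
rewrite [leqRHS]prod_prime_decomp// prime_decompE big_map big_mkcond/=.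
rewrite big_seq [leqRHS]big_seq; apply: leq_prod => q; rewrite -logn_gt0 => lq.
have q0 : (0 < q)%N by move: lq; rewrite lognE; case: ifP => // /andP[/prime_gt0].
case: ifP => Tq; last by rewrite expn_gt0 q0.
by apply: (leq_trans (ltnW Tq)); rewrite -{1}[q]expn1 leq_pexp2l.
Qed.

Section Tail.
Variables (O : comNzRingType) (n' : nat).
Local Notation n := n'.+1.
Variables (E : 'I_n -> O).
Hypothesis (hE : Zbasis E) (PID : is_PID O).
Local Notation cube := (cube_lattice E).

Lemma primes_above_seq (q : nat) : prime q -> exists s : seq (set O),
  [/\ uniq s, (size s <= n)%N & forall P, P \in s <-> nonzero_primes P /\ P q%:R].
Proof.
move=> pq; pose A : set (set O) := [set P | nonzero_primes P /\ P q%:R].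
have fA : finite_set A.
  (* An infinite set of primes above q would have a finite subset with n + 1 elements, against
     [primes_above]. *)
  apply: contrapT => /(infinite_set_fset n.+1) [B BA].
  rewrite leqNgt => /negP; apply; rewrite ltnS.
  by apply: (primes_above hE PID pq (fset_uniq B)) => P PB; exact: BA.
exists (fset_set A); split; first exact: fset_uniq.
  by apply: (primes_above hE PID pq (fset_uniq _)) => P; rewrite in_fset_set// => /set_mem.
by move=> P; rewrite in_fset_set//; split=> [/set_mem|/mem_set].
Qed.

Definition bad_pairs (q L : nat) (x0 x1 : O) : set (O * O) :=
  [set z | [/\ cube L z.1, cube L z.2 & exists P, [/\ nonzero_primes P, P q%:R,
    P (z.1 - x0) & P (z.2 - x1)]]].

Lemma bad_pairs_finite q L x0 x1 : finite_set (bad_pairs q L x0 x1).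
Proof.
apply: (@sub_finite_set _ _ (cube L `*` cube L)); first by move=> z [].
by apply: finite_setX; exact: cube_finite.
Qed.

Lemma bad_pairs_card q L x0 x1 : prime q ->
  (card (bad_pairs q L x0 x1) <= n * (((2 * L) %/ q).+1 * (2 * L).+1 ^ n') ^ 2)%N.
Proof.
move=> pq; have [s [us sn sP]] := primes_above_seq pq.
set k := (_ * _ ^ n')%N.
pose X P x : set O := cube L `&` residue_class P x.
have fX P x : finite_set (X P x) by apply: finite_setIl; exact: cube_finite.
have fXX P : finite_set (X P x0 `*` X P x1) by exact: finite_setX.
apply: (@leq_trans (card (\bigcup_(P in [set` s]) (X P x0 `*` X P x1)))).
  apply: card_sub; first by apply: bigcup_finite.
  by move=> z [z1 z2 [P [nP Pq P1 P2]]]; exists P => //=; apply/sP.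
apply: leq_trans (card_bigcup_le _) _ => //.
apply: (@leq_trans (\sum_(P <- s) k ^ 2)%N).
  rewrite big_seq [leqRHS]big_seq; apply: leq_sum => P /sP[nP Pq].
  rewrite card_setX// -mulnn leq_mul//; exact: coset_card.
by rewrite big_const_seq count_predT iter_addn_0 mulnC leq_mul2r sn orbT.
Qed.

(** All q > 2 L + 1 are treated at once, since summing a bound over infinitely many q would diverge.
    The exponent n + n' = 2 n - 1 is one less than the dimension of the space of pairs: either the
    first coordinate is fixed, or boundedly many primes confine the second one to cosets. *)
Lemma large_prime_pairs x0 x1 : exists L0 : nat, forall L, (L0 <= L)%N ->
  (card [set z | exists q, [/\ prime q, ((2 * L).+1 < q)%N & bad_pairs q L x0 x1 z]] <=
    (1 + n * n.+1) * (2 * L).+1 ^ (n + n'))%N.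
Proof.
have [C Cnorm] := abs_norm_bound hE.
pose B := \max_i absz (coord hE x0 0%R i).
(* [C] comes from the norm bound and [B] bounds the coordinates of [x0]; this threshold ensures C <=
   T and L + B <= T. *)
exists (1 + C + B)%N => L hL; set T := (2 * L).+1.
have CT : (C <= T)%N by rewrite /T; lia.
have T2 : (1 < T)%N by rewrite /T; lia.
have LB : (L + B <= T)%N by rewrite /T; lia.
pose K (z0 : O) : set O := [set z1 | z0 <> x0 /\
  exists q, [/\ prime q, (T < q)%N & bad_pairs q L x0 x1 (z0, z1)]].
have fK z0 : finite_set (K z0).
  by apply: sub_finite_set (cube_finite hE L) => z1 [_ [q [_ _ []]]].
have fW : finite_set [set z : O * O | z.1 = x0 /\ cube L z.2].
  apply: (finite_inj (f := snd) (cube_finite hE L)); first by move=> z [].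
  by move=> [a b] [c d] /= [-> _] [-> _] ->.
have fV : finite_set [set z : O * O | cube L z.1 /\ K z.1 z.2].
  apply: (@sub_finite_set _ _ (cube L `*` cube L)).
    by move=> [a b] /= [ca [_ [q [_ _ []]]]].
  by apply: finite_setX; exact: cube_finite.
apply: (@leq_trans (card ([set z : O * O | z.1 = x0 /\ cube L z.2] `|`
    [set z : O * O | cube L z.1 /\ K z.1 z.2]))).
  apply: card_sub; first by rewrite finite_setU.
  move=> [a b] [q [pq Tq bp]]; have [ca cb _] := bp; have [->|ax0] := pselect (a = x0).
    by left.
  by right; split => //=; split => //; exists q.
apply: leq_trans (card_setU_le fW fV) _; rewrite mulnDl leq_add//.
  rewrite mul1n (@leq_trans (card (cube L)))//.
    apply: (leq_card_inj (f := snd)); [exact: cube_finite|by move=> z []|].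
    by move=> [a b] [c d] /= [-> _] [-> _] ->.
  by apply: (leq_trans (cube_card hE L)); rewrite leq_pexp2l// leq_addr.
apply: leq_trans (@card_pairs_le _ _ _ _ (n * n.+1 * T ^ n')%N (cube_finite hE L) _ _) _ => //; last first.
  by rewrite mulnC expnD -!mulnA leq_mul2l leq_mul2l [X in (_ <= X)%N]mulnC leq_mul2l cube_card ?orbT.
move=> z0 cz0; have [->|zx] := pselect (z0 = x0).
  rewrite (_ : K x0 = set0) ?card_set0//; apply/seteqP; split => // z [].
  by [].
have w0 : z0 - x0 <> 0 by move/eqP; rewrite subr_eq0 => /eqP.
pose N := abs_norm hE (z0 - x0).
have N0 : (0 < N)%N by apply: abs_norm_gt0 => //; have [] := PID.
pose qs := [seq q <- primes N | (T < q)%N].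
(* T to the power [size qs] is at most the norm N, and N <= C (L + B)^n <= T^(n + 1). *)
have qsn : (size qs <= n.+1)%N.
  rewrite -(leq_exp2l _ _ T2); apply: leq_trans (large_primes_count _ N0) _.
  apply: leq_trans (Cnorm _ (L + B)%N _) _.
    move=> i; rewrite coordB !mxE; move/cubeP : cz0 => /(_ hE i).
    have : (absz (coord hE x0 0%R i) <= B)%N by exact: (leq_bigmax i).
    by move: (coord hE x0 0 i) (coord hE z0 0 i) => a b; clear; lia.
  by rewrite (expnS T) leq_mul// leq_exp2r.
pose U q : set O := [set z1 | bad_pairs q L x0 x1 (z0, z1)].
have fU q : finite_set (U q).
  by apply: sub_finite_set (cube_finite hE L) => z1 [].
apply: (@leq_trans (card (\bigcup_(q in [set` qs]) U q))).
  apply: card_sub; first exact: bigcup_finite.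
  move=> z1 [_ [q [pq Tq bp]]]; exists q => //=; rewrite mem_filter Tq /=.
  rewrite mem_primes pq N0 /=; have [_ _ [P [nP Pq P0 _]]] := bp.
  by apply: (prime_dvd nP pq Pq); exact: prime_abs_norm.
apply: leq_trans (card_bigcup_le _) _ => //.
apply: (@leq_trans (\sum_(q <- qs) (n * T ^ n'))%N); last first.
  rewrite big_const_seq count_predT iter_addn_0 -mulnA mulnCA.
  by rewrite [leqLHS]mulnC leq_mul// leq_mul2l qsn orbT.
rewrite big_seq [leqRHS]big_seq; apply: leq_sum => q.
rewrite mem_filter mem_primes => /and4P[Tq pq _ _].
have [s [us sn sP]] := primes_above_seq pq.
pose X P : set O := cube L `&` residue_class P x1.
have fX P : finite_set (X P) by apply: finite_setIl; exact: cube_finite.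
apply: (@leq_trans (card (\bigcup_(P in [set` s]) X P))).
  apply: card_sub; first by apply: bigcup_finite.
  by move=> z [z1 z2 [P [nP Pq P1 P2]]]; exists P => //=; apply/sP.
apply: leq_trans (card_bigcup_le _) _ => //.
apply: (@leq_trans (\sum_(P <- s) T ^ n')%N).
  rewrite big_seq [leqRHS]big_seq; apply: leq_sum => P /sP[nP Pq].
  (* As q > 2 L, the quotient of 2 L by q is 0, and the coset meets the cube in at most T^(n - 1)
     points. *)
  have := coset_card hE x1 L nP pq Pq; rewrite divn_small ?mul1n//.
  by move: Tq; rewrite /T; lia.
by rewrite big_const_seq count_predT iter_addn_0 mulnC leq_mul2r sn orbT.
Qed.

End Tail.

(** * From pairs of coordinates to whole rows *)

Section RowTail.
Variables (R : realType) (O : comNzRingType) (n' m' : nat).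
Local Notation n := n'.+1.
Local Notation m := m'.+2.
Variables (E : 'I_n -> O).
Hypothesis (hE : Zbasis E) (PID : is_PID O).
Local Notation cube := (cube_lattice E).
Local Notation T L := ((2 * L).+1%:R : R).

Definition pair_tail (M L : nat) (x0 x1 : O) : set (O * O) :=
  [set z | exists q, [/\ prime q, (M < q)%N & bad_pairs E q L x0 x1 z]].

Lemma pair_tail_finite M L x0 x1 : finite_set (pair_tail M L x0 x1).
Proof.
apply: (@sub_finite_set _ _ (cube L `*` cube L)); first by move=> z [q [_ _ []]].
by apply: finite_setX; exact: cube_finite.
Qed.

(** The primes are cut at T = 2 L + 1: up to T the bounds are summed against q^-2, beyond T
    [large_prime_pairs] applies. The threshold [L0] is uniform in [M], which lets M be fixed before
    L grows. *)
Lemma pair_tail_card x0 x1 : exists L0 : nat, forall M L, (0 < M)%N -> (L0 <= L)%N ->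
  (card (pair_tail M L x0 x1))%:R <=
  T L ^+ (n + n) * ((4 * n)%:R / M%:R + (1 + n * n.+1)%:R / T L).
Proof.
have [L0 hL0] := large_prime_pairs hE PID x0 x1; exists L0 => M L M0 hL.
pose X q := [set z | prime q /\ bad_pairs E q L x0 x1 z].
pose s := index_iota M.+1 (2 * L).+2.
have fX q : finite_set (X q).
  by apply: sub_finite_set (bad_pairs_finite hE q L x0 x1) => z [].
set Y := [set z | exists q, [/\ prime q, ((2 * L).+1 < q)%N & bad_pairs E q L x0 x1 z]].
have fY : finite_set Y by apply: pair_tail_finite.
have T0 : 0 < T L by rewrite ltr0n.
apply: (@le_trans _ _ (\sum_(q <- s) (card (X q))%:R + (card Y)%:R)).
  rewrite -natr_sum -natrD ler_nat.
  apply: (@leq_trans (card ((\bigcup_(q in [set` s]) X q) `|` Y))).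
    apply: card_sub; first by rewrite finite_setU; split => //; exact: bigcup_finite.
    move=> z [q [pq Mq bp]]; have [qT|Tq] := leqP q (2 * L).+1; last by right; exists q.
    by left; exists q => //=; rewrite mem_index_iota Mq ltnS.
  apply: leq_trans (card_setU_le _ fY) _; first exact: bigcup_finite.
  by rewrite leq_add2r; apply: card_bigcup_le => q _.
rewrite mulrDr lerD//; last first.
  have := hL0 L hL; rewrite -(ler_nat R) => /le_trans; apply.
  rewrite natrM natrX addnS exprS mulrC.
  by rewrite [leRHS](_ : _ = T L ^+ (n + n') * (1 + n * n.+1)%:R)//; field; rewrite gt_eqF.
apply: (@le_trans _ _ (\sum_(q <- s) (T L ^+ (n + n) * (4 * n)%:R) * q%:R ^- 2)).
  rewrite /s big_nat [leRHS]big_nat; apply: ler_sum => q /andP[Mq qT].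
  have q0 : 0 < q%:R :> R by rewrite ltr0n (leq_trans _ Mq).
  have [pq|npq] := boolP (prime q); last first.
    rewrite (_ : X q = set0) ?card_set0 ?mulr_ge0 ?exprn_ge0 ?invr_ge0 ?exprn_ge0 ?ler0n//.
    by apply/seteqP; split => // z [h]; rewrite h in npq.
  apply: (@le_trans _ _ (n * (((2 * L) %/ q).+1 * (2 * L).+1 ^ n') ^ 2)%N%:R).
    rewrite ler_nat; apply: leq_trans (bad_pairs_card hE PID L x0 x1 pq).
    by apply: card_sub; [exact: bad_pairs_finite|move=> z []].
  (* Both 2 L / q and 1 are at most T / q because q <= T. The square of this factor 2 is the 4 in 4
     n. *)
  have h : ((2 * L) %/ q).+1%:R <= 2 * T L / q%:R.
    rewrite ler_pdivlMr//; have -> : 2 * T L = (2 * (2 * L).+1)%:R by rewrite [RHS]natrM.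
    rewrite -natrM ler_nat.
    by have := leq_trunc_div (2 * L) q; rewrite mulSn; lia.
  rewrite natrM natrX natrM natrX.
  apply: (@le_trans _ _ (n%:R * (2 * T L / q%:R * T L ^+ n') ^+ 2)).
    by rewrite ler_wpM2l// lerXn2r ?nnegrE ?ler_wpM2r ?mulr_ge0 ?exprn_ge0 ?invr_ge0// ltW.
  rewrite natrM addSn addnS !exprS exprD le_eqVlt; apply/orP; left; apply/eqP.
  by field; rewrite gt_eqF.
rewrite -big_distrr/= -mulrA ler_wpM2l ?exprn_ge0// ler_wpM2l//.
have [MT|TM] := leqP M (2 * L).+1; last by rewrite /s /index_iota big_geq ?invr_ge0// ltnW.
apply: le_trans (sum_inv_square R M0 MT) _.
by rewrite gerBl invr_ge0.
Qed.

Definition row_tail (S : {fset 'rV[O]_m}) (M L : nat) : set 'rV[O]_m :=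
  [set z | (forall i, cube L (z 0 i)) /\
    exists2 x, x \in S & exists q P, [/\ prime q, (M < q)%N, nonzero_primes P, P q%:R &
      forall i, P (z 0 i - x 0 i)]].

Lemma row_tail_finite S M L : finite_set (row_tail S M L).
Proof.
have [h _] := card_rows (fun _ : 'I_m => cube_finite hE L).
by apply: sub_finite_set h => z [].
Qed.

(** Only the first two coordinates are constrained; the other m - 2 range freely over the cube.
    Summing over the points of [S] gives the factor |S|. *)
Lemma row_tail_card (S : {fset 'rV[O]_m}) : exists L0 : nat, forall M L,
  (0 < M)%N -> (L0 <= L)%N ->
  (card (row_tail S M L))%:R <=
  T L ^+ (n * m) * #|` S|%:R * ((4 * n)%:R / M%:R + (1 + n * n.+1)%:R / T L).
Proof.
have L0x (x : 'rV[O]_m) := pair_tail_card (x 0 ord0) (x 0 (lift ord0 ord0)).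
pose L0 x := projT1 (cid (L0x x)).
exists (\max_(x <- S) L0 x)%N => M L M0 hL.
set e := _ / M%:R + _.
pose X (x : 'rV[O]_m) : set 'rV[O]_m := [set z | (forall i, cube L (z 0 i)) /\
  pair_tail M L (x 0 ord0) (x 0 (lift ord0 ord0)) (z 0 ord0, z 0 (lift ord0 ord0))].
have [fr cr] := card_rows (fun _ : 'I_m' => cube_finite hE L).
set rest := [set a : 'rV[O]_m' | _] in fr cr.
have [fm _] := card_rows (fun _ : 'I_m => cube_finite hE L).
have fX x : finite_set (X x) by apply: sub_finite_set fm => z [].
apply: (@le_trans _ _ (\sum_(x <- S) (card (X x))%:R)).
  rewrite -natr_sum ler_nat.
  apply: leq_trans (card_bigcup_le _); last by move=> x _; exact: fX.
  apply: card_sub; first by apply: bigcup_finite.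
  move=> z [zL [x xS [q [P [pq Mq nP Pq Pz]]]]]; exists x => //; split => //.
  by exists q; split => //; split; [exact: zL|exact: zL|exists P; split => //; exact: Pz].
apply: (@le_trans _ _ (\sum_(x <- S) T L ^+ (n * m) * e)); last first.
  by rewrite big_const_seq count_predT iter_addr_0 -[leLHS]mulr_natr mulrAC lexx.
rewrite big_seq [leRHS]big_seq; apply: ler_sum => x xS.
have := projT2 (cid (L0x x)) M L M0; rewrite -/(L0 x) => h.
have {}h := h (leq_trans (leq_bigmax_seq _ xS isT) hL).
apply: (@le_trans _ _ ((card (pair_tail M L (x 0 ord0) (x 0 (lift ord0 ord0))))%:R *
    T L ^+ (n * m'))).
  rewrite -natrX -natrM ler_nat.
  apply: (@leq_trans (card (pair_tail M L (x 0 ord0) (x 0 (lift ord0 ord0)) `*` rest))).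
    pose f (z : 'rV[O]_m) := ((z 0 ord0, z 0 (lift ord0 ord0)),
        \row_i z 0 (lift ord0 (lift ord0 i))).
    apply: (leq_card_inj (f := f)).
    - by apply: finite_setX => //; exact: pair_tail_finite.
    - by move=> z [zL zt]; split => //= i; rewrite mxE.
    - move=> z w _ _ [e0 e1 /rowP e2]; apply/rowP => i.
      case: (unliftP ord0 i) => [j ->|->] //; case: (unliftP ord0 j) => [k ->|->] //.
      by have := e2 k; rewrite !mxE.
  rewrite card_setX ?leq_mul//; last exact: pair_tail_finite.
  rewrite cr prod_nat_const card_ord expnM.
  by case: m' => [|k] //; rewrite leq_exp2r// cube_card.
have -> : T L ^+ (n * m) = T L ^+ (n + n) * T L ^+ (n * m').
  by rewrite -exprD; congr (_ ^+ _); rewrite !mulnS addnA.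
by rewrite mulrAC ler_wpM2r ?exprn_ge0.
Qed.

End RowTail.

(** * The density along an averaging family *)

Section DensityAlongFamily.
Variables (R : realType) (O : comNzRingType) (n' m' : nat).
Local Notation n := n'.+1.
Local Notation m := m'.+2.
Variables (E : 'I_n -> O).
Hypothesis (hE : Zbasis E) (PID : is_PID O).
Local Notation cube := (cube_lattice E).
Variables (X : Type) (F : set_system X) (FF : Filter F).
Variables (A : X -> set O) (L : X -> nat) (V : X -> R) (K : R).
Hypothesis A_cube : forall x, A x `<=` cube (L x).
Hypothesis L_infty : L x @[x --> F] --> \oo.
Hypothesis V_pos : \forall x \near F, 0 < V x.
Hypothesis V_large : \forall x \near F, ((2 * L x).+1%:R) ^+ n <= K * V x.
Hypothesis equidistributed : forall (Q : nat) (c : O), (0 < Q)%N ->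
  (card (A x `&` [set y | exists w, y - c = w *+ Q]))%:R / V x @[x --> F] -->
  ((Q%:R : R) ^+ n)^-1.
Variable S : {fset 'rV[O]_m}.
Hypothesis adm : admissible S.

Lemma A_finite x : finite_set (A x).
Proof. exact: sub_finite_set (A_cube (x := x)) (cube_finite hE _). Qed.

Definition A_rows x : set 'rV[O]_m := [set a | forall i, A x (a 0 i)].

Lemma A_rows_finite x : finite_set (A_rows x).
Proof. by have [] := card_rows (fun _ : 'I_m => A_finite x). Qed.

(** A periodic set is a finite disjoint union of classes modulo Q. Each class is a product over the
    m coordinates, and equidistribution gives every factor the density Q^-n. *)
Lemma periodic_density (Q : nat) (G : finType) (red : O -> G) (lft : G -> O)
    (U : set 'rV[O]_m) : (0 < Q)%N -> (forall g, red (lft g) = g) ->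
  (forall x y, red x = red y <-> exists w, x - y = w *+ Q) ->
  periodic Q U ->
  proportion U (A x) (V x) @[x --> F] --> (class_count lft U)%:R / (Q%:R : R) ^+ (n * m).
Proof.
move=> Q0 lftK redP pU.
pose W := [set g : 'rV[G]_m | U (map_mx lft g)].
have fW : finite_set W by exact: finite_finset.
pose C g x := card (A x `&` [set y | exists w, y - lft g = w *+ Q]).
have eqp x : proportion U (A x) (V x) =
    \sum_(g <- fset_set W) \prod_(i < m) ((C (g 0 i) x)%:R / V x).
  rewrite /proportion -/(A_rows x).
  have -> : A_rows x `&` U = \bigcup_(g in [set` fset_set W])
      [set a | forall i, (A x `&` [set y | exists w, y - lft (g 0 i) = w *+ Q]) (a 0 i)].
    apply/seteqP; split => [z [Az Uz]|z [g /= gW zg]].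
      have zr i : exists w, z 0 i - lft (red (z 0 i)) = w *+ Q by apply/redP; rewrite lftK.
      exists (map_mx red z) => /=; last by move=> i; rewrite mxE; split; [exact: Az|exact: zr].
      rewrite in_fset_set//; apply/mem_set; apply: pU Uz => i; rewrite !mxE; exact: zr.
    split=> [i|]; first by have [] := zg i.
    move: gW; rewrite in_fset_set// => /set_mem; apply: pU => i; rewrite !mxE.
    have [_ [w e]] := zg i; exists (- w); rewrite mulNrn -e; ring.
  have fC i (g : 'rV[G]_m) : finite_set (A x `&` [set y | exists w, y - lft (g 0 i) = w *+ Q]).
    by apply: finite_setIl; exact: A_finite.
  rewrite card_bigcup ?fset_uniq//; last 2 first.
  - by move=> g; have [] := card_rows (fun i => fC i g).
  - move=> g h z _ _ zg zh; apply/rowP => i; have [_ [w e]] := zg i; have [_ [w' e']] := zh i.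
    rewrite -(lftK (g 0 i)) -(lftK (h 0 i)); apply/redP; exists (w' - w).
    by rewrite mulrnBl -e -e'; ring.
  rewrite natr_sum mulr_suml; apply: eq_bigr => g _.
  have [_ ->] := card_rows (fun i => fC i g).
  rewrite natr_prod big_split/= prodr_const card_ord exprVn; congr (_ * _).
under eq_cvg do rewrite eqp.
have -> : (class_count lft U)%:R / Q%:R ^+ (n * m) =
    \sum_(g <- fset_set W) \prod_(i < m) (Q%:R ^+ n)^-1 :> R.
  rewrite big_const_seq count_predT iter_addr_0 prodr_const card_ord.
  by rewrite -exprVn exprM -[RHS]mulr_natl -exprVn.
apply: cvg_big; first exact: add_continuous.
by move=> g _; apply: cvg_big; [exact: mul_continuous|move=> i _; exact: equidistributed].
Qed.

(** The product of rational primes lying below the listed ideals is a common period. *)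
Lemma good_period (s : seq (set O)) : (forall P, P \in s -> nonzero_primes P) ->
  exists2 Q : nat, (0 < Q)%N & forall P, P \in s -> good_prime Q P.
Proof.
elim: s => [_|P s IH hs]; first by exists 1%N.
have [|Q Q0 hQ] := IH; first by move=> P' h; apply: hs; rewrite inE h orbT.
have nP := hs P (mem_head _ _); have [p pp Pp] := prime_over_nat hE PID.1 nP.
exists (p * Q)%N; first by rewrite muln_gt0 prime_gt0.
move=> P'; rewrite inE => /orP[/eqP ->|/hQ [nP' P'Q]]; split => //; rewrite natrM.
  exact: primeMl.
exact: primeMr.
Qed.

Lemma avoid_density (s : seq (set O)) : uniq s -> (forall P, P \in s -> nonzero_primes P) ->
  proportion (avoid S s) (A x) (V x) @[x --> F] -->
  \prod_(P <- s) euler_factor R m #|` S| P.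
Proof.
move=> us hs; have [Q Q0 hQ] := good_period hs.
have [G [red [lft [cG lftK redP]]]] := residues hE Q0.
have := periodic_density Q0 lftK redP (periodic_avoid (S := S) hQ).
rewrite (class_count_avoid R PID lftK redP adm us hQ).
have -> : (class_count lft [set: 'rV[O]_m])%:R = Q%:R ^+ (n * m) :> R.
  rewrite -natrX; congr (_%:R); rewrite /class_count.
  have -> : [set g : 'rV[G]_m | [set: 'rV[O]_m] (map_mx lft g)] = setT by apply/seteqP; split.
  by rewrite card_setT card_mx cG mul1n expnM.
by rewrite mulrAC mulfV ?mul1r// expf_neq0// pnatr_eq0 -lt0n.
Qed.

Lemma visible_fromP z : visible_from S z <->
  forall P x, nonzero_primes P -> x \in S -> ~ (forall i, P (z 0 i - x 0 i)).
Proof.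
split=> [h P x nP xS|h x xS]; first by apply: visible_prime nP; exact: h.
(* The integer 2 is the nonzero non-unit required. *)
apply: (@visibleP _ _ z x 2%:R (nat_nonzero hE _) (nat_nonunit hE _)) => // P nP; exact: h.
Qed.

Lemma small_primes (M : nat) : exists s : seq (set O), uniq s /\
  forall P, P \in s <-> nonzero_primes P /\ exists q, [/\ prime q, (q <= M)%N & P q%:R].
Proof.
elim: M => [|M [s [us hs]]].
  exists [::]; split => // P; split => // -[_ [q [pq q0 _]]].
  by move: (prime_gt0 pq); rewrite ltnNge q0.
have [pM|pM] := boolP (prime M.+1); last first.
  exists s; split => // P; rewrite hs; split => -[nP [q [pq qM Pq]]]; split => //; exists q; split => //.
    exact: leqW.
  by move: qM; rewrite leq_eqVlt => /orP[/eqP e|//]; rewrite -e pq in pM.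
have [s' [_ _ hs']] := primes_above_seq hE PID pM.
exists (undup (s' ++ s)); split; first exact: undup_uniq.
move=> P; rewrite mem_undup mem_cat; split.
  case/orP => [/hs'[nP PM]|/hs[nP [q [pq qM Pq]]]]; split => //; first by exists M.+1.
  by exists q; split => //; exact: leqW.
move=> [nP [q [pq + Pq]]]; rewrite leq_eqVlt => /orP[/eqP e|qM].
  by apply/orP; left; apply/hs'; rewrite -e.
by apply/orP; right; apply/hs; split => //; exists q.
Qed.

Local Notation euler := (@euler_factor R O m #|` S|).
Let euler01 P : nonzero_primes P -> 0 <= euler P <= 1.
Proof. exact: euler_factor_bounds. Qed.

(** A sandwich: V(S) lies in [avoid S s0] for any finite list [s0] of nonzero primes, while
    [avoid S s1], with [s1] the primes above all q <= M, exceeds V(S) inside the box only by points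
    of [row_tail]. *)
Lemma density_limit : proportion (visible_from S) (A x) (V x) @[x --> F] -->
  infinite_prod (@nonzero_primes O) euler.
Proof.
set d := infinite_prod _ _.
apply/cvgrPdist_le => e e0.
have proportion_le (U U' : set 'rV[O]_m) x : 0 < V x -> U `<=` U' ->
    proportion U (A x) (V x) <= proportion U' (A x) (V x).
  move=> Vx UU'; rewrite /proportion ler_wpM2r ?invr_ge0 ?exprn_ge0 ?(ltW Vx)// ler_nat.
  by apply: card_sub; [apply: finite_setIl; exact: A_rows_finite|exact: setIS].
have e2 : 0 < e / 2 by rewrite divr_gt0.
have [B hB] := infinite_prod_approx euler01 e2.
pose s0 := [seq P <- B | P \in @nonzero_primes O].
have us0 : uniq s0 by rewrite filter_uniq// fset_uniq.
have hs0 P : P \in s0 -> nonzero_primes P by rewrite mem_filter => /andP[/set_mem].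
have /cvgrPdist_lt /(_ (e / 2) e2) lim0 := avoid_density us0 hs0.
have p0 : \prod_(P <- s0) euler P = partial_prod (@nonzero_primes O) euler B.
  by rewrite /s0 big_filter.
(* A positive constant is wanted, so that the comparison can be raised to the power m with
   nonnegative coefficients. *)
have K0 : exists2 K', 0 < K' & \forall x \near F, ((2 * L x).+1%:R) ^+ n <= K' * V x.
  exists (`|K| + 1); first by rewrite ltr_wpDl.
  near=> x; apply: (@le_trans _ _ (K * V x)); first by near: x.
  have Vx : 0 < V x by near: x.
  by rewrite ler_wpM2r// ?(ltW Vx)// (le_trans (ler_norm _))// lerDl.
have [K' K'0 VK'] := K0.
(* By (2 L + 1)^(n m) <= (K' V)^m, the tail has proportion at most D1 / M + D2 / (2 L + 1). First M,
   then L, makes each term at most e / 4. *)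
pose D := K' ^+ m * #|` S|%:R.
have D0 : 0 <= D by rewrite mulr_ge0// exprn_ge0// ltW.
pose D1 := D * (4 * n)%:R; pose D2 := D * (1 + n * n.+1)%:R.
have D10 : 0 <= D1 by rewrite mulr_ge0.
have D20 : 0 <= D2 by rewrite mulr_ge0.
have [M M0 hM] : exists2 M : nat, (0 < M)%N & D1 / M%:R <= e / 4.
  exists (Num.truncn (D1 * 4 / e)).+1 => //.
  rewrite ler_pdivrMr ?ltr0n//.
  have := ltW (truncnS_gt (D1 * 4 / e)).
  rewrite ler_pdivrMr// => h; lra.
have [s1 [us1 hs1]] := small_primes M.
have ns1 P : P \in s1 -> nonzero_primes P by move=> /hs1[].
have e4 : 0 < e / 4 by rewrite divr_gt0.
have /cvgrPdist_lt /(_ (e / 4) e4) lim1 := avoid_density us1 ns1.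
have p1 : d <= \prod_(P <- s1) euler P.
  have -> : \prod_(P <- s1) euler P = partial_prod (@nonzero_primes O) euler [fset P in s1]%fset.
    rewrite /partial_prod -[RHS]big_filter; apply: perm_big; apply: uniq_perm => //.
      by rewrite filter_uniq// fset_uniq.
    move=> P; rewrite mem_filter !inE /=; case: (boolP (P \in s1)) => h; rewrite ?andbF ?andbT//.
    by apply/esym/mem_set/ns1.
  exact: infinite_prod_le.
have [L0 hL0] := row_tail_card R hE PID S.
near=> x.
have Vx : 0 < V x by near: x.
have VKx : ((2 * L x).+1%:R) ^+ n <= K' * V x by near: x.
have Lx : (L0 <= L x)%N by near: x; move/cvgnyPge : L_infty; apply.
have Lx2 : D2 / (2 * L x).+1%:R <= e / 4.
  have : (Num.truncn (D2 * 4 / e) <= L x)%N by near: x; move/cvgnyPge : L_infty; apply.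
  move=> h; rewrite ler_pdivrMr ?ltr0n//.
  have h1 := ltW (truncnS_gt (D2 * 4 / e)).
  have : D2 * 4 / e <= (2 * L x).+1%:R.
    by apply: le_trans h1 _; rewrite ler_nat ltnS (leq_trans h)// leq_pmull.
  rewrite ler_pdivrMr// => h2; lra.
have up : proportion (visible_from S) (A x) (V x) <= d + e.
  apply: (@le_trans _ _ (proportion (avoid S s0) (A x) (V x))).
    apply: proportion_le => // z /visible_fromP hz P y Ps0 yS; apply: hz => //; exact: hs0.
  have : `|\prod_(P <- s0) euler P - proportion (avoid S s0) (A x) (V x)| < e / 2 by near: x.
  rewrite p0 ltr_norml => /andP[]; move: hB; rewrite -/d; lra.
have lo : d - e <= proportion (visible_from S) (A x) (V x).
  have : `|\prod_(P <- s1) euler P - proportion (avoid S s1) (A x) (V x)| < e / 4 by near: x.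
  suff : proportion (avoid S s1) (A x) (V x) <=
      proportion (visible_from S) (A x) (V x) + (D1 / M%:R + D2 / (2 * L x).+1%:R).
    rewrite ltr_norml => h /andP[_ h2]; move: hM Lx2 p1 h h2.
    move: (D1 / _) (D2 / _) (\prod_(P <- s1) _) (proportion (avoid S s1) _ _) (proportion (visible_from S) _ _).
    by move=> a b p q r *; lra.
  (* A point of [avoid S s1] outside V(S) is congruent to a point of [S] modulo a prime lying above
     some q > M, hence belongs to [row_tail]. *)
  apply: (@le_trans _ _ (proportion (visible_from S) (A x) (V x) +
     (card (row_tail E S M (L x)))%:R / V x ^+ m)).
    rewrite /proportion -mulrDl ler_wpM2r ?invr_ge0 ?exprn_ge0 ?(ltW Vx)//.
    rewrite -natrD ler_nat.
    have f1 : finite_set (A_rows x `&` visible_from S) by apply: finite_setIl; exact: A_rows_finite.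
    have f2 := row_tail_finite hE S M (L x).
    apply: leq_trans (card_setU_le f1 f2); apply: card_sub; first by rewrite finite_setU.
    move=> z [zA zs1]; have [zv|zv] := pselect (visible_from S z); [by left|right].
    split; first by move=> i; apply: A_cube; exact: zA.
    apply: contrapT => h; apply: zv; apply/visible_fromP => P y nP yS Pzy.
    have [q pq Pq] := prime_over_nat hE PID.1 nP.
    have [qM|Mq] := leqP q M; last by apply: h; exists y => //; exists q, P.
    by apply: (zs1 P y _ yS Pzy); apply/hs1; split => //; exists q.
  rewrite lerD2l ler_pdivrMr ?exprn_gt0//.
  apply: le_trans (hL0 M (L x) M0 Lx) _.
  have -> : (D1 / M%:R + D2 / (2 * L x).+1%:R) * V x ^+ m = (K' * V x) ^+ m * #|` S|%:R *
     ((4 * n)%:R / M%:R + (1 + n * n.+1)%:R / (2 * L x).+1%:R).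
    by rewrite exprMn /D1 /D2 /D; ring.
  rewrite ler_wpM2r ?addr_ge0 ?mulr_ge0 ?invr_ge0// ler_wpM2r// exprM.
  by rewrite lerXn2r ?nnegrE ?exprn_ge0// mulr_ge0//; exact: ltW.
rewrite ler_norml; lra.
Unshelve. all: by end_near.
Qed.

End DensityAlongFamily.

(** * Averaging over cubes *)

Section IntervalCount.
Variable R : realType.

Definition progression (Q : nat) (c : int) : set int := [set k | (Q%:Z %| k - c)%Z].

(** Writing k = j Q + c, the index j runs from the ceiling of (al - c) / Q through at most floor((be
    - al) / Q) + 1 values. *)
Lemma progression_interval (Q : nat) (c : int) (al be : R) : (0 < Q)%N -> al <= be ->
  finite_set ([set k : int | al <= k%:~R <= be] `&` progression Q c) /\
  (card ([set k : int | al <= k%:~R <= be] `&` progression Q c))%:R <=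
    (be - al) / Q%:R + 1 :> R.
Proof.
move=> Q0 ab; set X := _ `&` _.
have QR : 0 < Q%:R :> R by rewrite ltr0n.
pose u := (al - c%:~R) / Q%:R; pose N := Num.truncn ((be - al) / Q%:R).
have w0 : 0 <= (be - al) / Q%:R by rewrite divr_ge0// subr_ge0.
have jP k : X k -> exists j : int, [/\ k = j * Q%:Z + c,
    0 <= j - Num.ceil u & (absz (j - Num.ceil u) <= N)%N].
  move=> [/= /andP[ak kb] /dvdzP[j e]]; exists j.
  have kE : k = j * Q%:Z + c by rewrite -e subrK.
  have kR : k%:~R = j%:~R * Q%:R + c%:~R :> R by rewrite kE rmorphD rmorphM.
  have uj : u <= j%:~R by rewrite /u ler_pdivrMr// lerBlDr -kR.
  have h0 : 0 <= j - Num.ceil u by rewrite subr_ge0 ceil_le_int.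
  split => //; rewrite /N truncn_ge_nat//.
  rewrite pmulrn gez0_abs// rmorphB/= ler_pdivlMr// mulrBl.
  have := ceil_ge u; rewrite {1}/u ler_pdivrMr// => h; lra.
pose q (k : int) : int := ((k - c) %/ Q%:Z)%Z.
pose f (k : int) : 'I_N.+1 := inord (absz (q k - Num.ceil u)).
have fj k j : k = j * Q%:Z + c -> q k = j.
  by move=> ->; rewrite /q addrK mulzK// -lt0n.
have fI k l : X k -> X l -> f k = f l -> k = l.
  move=> /jP [j [kE j0 jN]] /jP [i [lE i0 iN]] /(congr1 (@nat_of_ord _)).
  rewrite /f (fj _ _ kE) (fj _ _ lE) !inordK ?ltnS// => e.
  suff ji : j = i by rewrite kE lE ji.
  have : (absz (j - Num.ceil u))%:Z = (absz (i - Num.ceil u))%:Z by rewrite e.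
  by rewrite !gez0_abs// => /addIr.
split; first by apply: (@finite_inj _ _ _ setT f) => //; exact: finite_finset.
apply: (@le_trans _ _ N.+1%:R).
  rewrite ler_nat -[X in (_ <= X)%N]card_ord; exact: (leq_card_finType (f := f)).
by rewrite -natr1 lerD2r truncn_le.
Qed.

(** The interval [-L, L] contains floor(2 L / Q) disjoint blocks of Q consecutive integers, and each
    block meets the progression once. *)
Lemma progression_symmetric (Q L : nat) (c : int) : (0 < Q)%N ->
  ((2 * L) %/ Q <= card ([set k : int | (- L%:Z <= k <= L%:Z)%R] `&` progression Q c))%N.
Proof.
move=> Q0; set t := ((2 * L) %/ Q)%N; set X := _ `&` _.
have fX : finite_set X.
  apply: (@finite_inj _ _ _ setT (shift_coord L)) => //; first exact: finite_finset.
  by move=> k l [/= kL _] [/= lL _]; apply: shift_coord_inj; lia.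
rewrite -[X in (X <= _)%N]card_ord -card_setT.
have m0 : 0 <= ((c + L%:Z) %% Q%:Z)%Z by rewrite modz_ge0; lia.
have mQ : ((c + L%:Z) %% Q%:Z)%Z < Q%:Z by rewrite ltz_pmod; lia.
apply: (leq_card_inj (f := fun s : 'I_t => s%:Z * Q%:Z - L%:Z + ((c + L%:Z) %% Q%:Z)%Z)) => //.
  move=> s _; split => /=.
    have : (s.+1 * Q <= 2 * L)%N.
      by apply: leq_trans (leq_trunc_div (2 * L) Q); rewrite leq_mul2r ltn_ord orbT.
    rewrite mulSn => h; have : (s * Q)%N%:Z = s%:Z * Q%:Z by rewrite PoszM.
    move: m0 mQ h; move: (_ %% _)%Z (s%:Z * _) => a b; lia.
  rewrite /progression/= (_ : _ - c = (s%:Z - ((c + L%:Z) %/ Q%:Z)%Z) * Q%:Z); last first.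
    have := divz_eq (c + L%:Z) Q%:Z.
    move: ((c + L%:Z) %/ Q%:Z)%Z ((c + L%:Z) %% Q%:Z)%Z => a b e.
    have -> : c = a * Q%:Z + b - L%:Z by rewrite -e addrK.
    ring.
  exact: dvdz_mull.
move=> s s' _ _ /= /addIr /addIr /mulIf e; apply/val_inj.
by have := e (_ : Q%:Z != 0); rewrite -lt0n => /(_ Q0) [].
Qed.

End IntervalCount.

Section CubeDensity.
Variables (R : realType) (O : comNzRingType) (n' : nat).
Local Notation n := n'.+1.
Variables (E : 'I_n -> O).
Hypothesis (hE : Zbasis E).

(** Congruence modulo Q in O is congruence of every coordinate, so a residue class becomes a product
    of progressions. *)
Lemma card_combination (A : set 'rV[int]_n) (Q : nat) (c : O) : finite_set A ->
  card ([set combination E a | a in A] `&` [set y | exists w, y - c = w *+ Q]) =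
  card (A `&` [set a | forall i, progression Q (coord hE c 0 i) (a 0 i)]).
Proof.
move=> fA; apply: (@card_eq_bij _ _ _ _ (coord hE) (combination E)).
- exact: finite_setIl.
- move=> _ [[a Aa <-] [w e]]; rewrite combK; split => // i.
  move: (congr1 (coord hE) e); rewrite coordB combK pmulrn coordZ => /rowP /(_ i).
  by rewrite !mxE /progression/= => ->; exact: dvdz_mulr.
- move=> a [Aa ac]; split; first by exists a.
  have h i : exists k, a 0 i - coord hE c 0 i = k * Q%:Z by exact/dvdzP/ac.
  exists (combination E (\row_i projT1 (cid (h i)))); apply: (coord_inj (hE := hE)).
  rewrite coordB combK pmulrn coordZ combK; apply/rowP => i; rewrite !mxE.
  by case: cid => k /= ->; rewrite mulrC.
- by move=> x _; exact: coordK.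
- by move=> a _; exact: combK.
Qed.

(** The count differs from 2 L / Q by at most 1, which gives an error of at most 1 / (2 L). *)
Lemma interval_density (Q : nat) (c : int) : (0 < Q)%N ->
  (card ([set k : int | (- L%:Z <= k <= L%:Z)%R] `&` progression Q c))%:R / (2 * L%:R)
   @[L --> \oo] --> (Q%:R : R)^-1.
Proof.
move=> Q0; have QR : 0 < Q%:R :> R by rewrite ltr0n.
have inv0 : (2 * L%:R : R)^-1 @[L --> \oo] --> (0 : R).
  apply/gtr0_cvgV0; first by near=> L; rewrite mulr_gt0// ltr0n; near: L; exact: nbhs_infty_gt.
  apply/cvgryPge => B; near=> L; have : B <= L%:R by near: L; exact: nbhs_infty_ger.
  by move=> /le_trans; apply; rewrite ler_peMl// ler1n.
apply: (@squeeze_cvgr _ _ _ _ (fun L => Q%:R^-1 - (2 * L%:R : R)^-1)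
                         (fun L => Q%:R^-1 + (2 * L%:R : R)^-1)).
- near=> L; have L0 : 0 < 2 * L%:R :> R.
    by rewrite mulr_gt0// ltr0n; near: L; exact: nbhs_infty_gt.
  have DE : 2 * L%:R = (2 * L)%:R :> R by rewrite natrM.
  rewrite DE in L0 *; set D := (2 * L)%:R in L0 *.
  rewrite ler_pdivlMr// ler_pdivrMr// mulrBl mulrDl mulVf ?gt_eqF//.
  apply/andP; split.
    apply: (@le_trans _ _ ((2 * L) %/ Q)%:R); last by rewrite ler_nat progression_symmetric.
    rewrite lerBlDr natr1 mulrC ler_pdivrMr// -natrM ler_nat ltnW//.
    exact: ltn_ceil.
  have LL : - L%:R <= L%:R :> R by rewrite (@le_trans _ _ 0)// oppr_le0.
  have [_] := progression_interval c Q0 LL.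
  rewrite opprK -[L%:R + L%:R]natrD addnn -mul2n -/D mulrC.
  apply: le_trans; rewrite ler_nat leq_eqVlt; apply/orP; left; apply/eqP.
  congr card; apply/seteqP; split => k [/= kL kc]; split => //=.
    by rewrite -[L%:R]/(L%:Z%:~R) -intrN !ler_int.
  by move: kL; rewrite -[L%:R]/(L%:Z%:~R) -intrN !ler_int.
- by rewrite -[X in _ --> X]subr0; apply: cvgB => //; exact: cvg_cst.
- by rewrite -[X in _ --> X]addr0; apply: cvgD => //; exact: cvg_cst.
Unshelve. all: by end_near.
Qed.

Lemma cube_equidistributed (Q : nat) (c : O) : (0 < Q)%N ->
  (card (cube_lattice E L `&` [set y | exists w, y - c = w *+ Q]))%:R / cube_volume R n L
   @[L --> \oo] --> ((Q%:R : R) ^+ n)^-1.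
Proof.
move=> Q0.
pose I L := [set k : int | (- L%:Z <= k <= L%:Z)%R].
have fI L d : finite_set (I L `&` progression Q d).
  apply: (@finite_inj _ _ _ setT (shift_coord L)) => //; first exact: finite_finset.
  by move=> k l [+ _] [+ _]; rewrite /I /= => kL lL; apply: shift_coord_inj; lia.
have e L : (card (cube_lattice E L `&` [set y | exists w, y - c = w *+ Q]))%:R / cube_volume R n L
    = \prod_(i < n) ((card (I L `&` progression Q (coord hE c 0 i)))%:R / (2 * L%:R)) :> R.
  rewrite card_combination; last first.
    apply: (@finite_inj _ _ _ _ (combination E) (cube_finite hE L)).
      by move=> a aL; exists a.
    by move=> a b _ _ ab; rewrite -(combK hE a) ab combK.
  rewrite (_ : _ `&` _ = [set a : 'rV[int]_n | forall i,
      (I L `&` progression Q (coord hE c 0 i)) (a 0 i)]); last first.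
    apply/seteqP; split => [a [a1 a2] i|a h]; first by split; [exact: a1|exact: a2].
    by split => i; have [] := h i.
  have [_ ->] := card_rows (fun i => fI L (coord hE c 0 i)).
  by rewrite natr_prod big_split/= prodr_const card_ord /cube_volume exprVn.
under eq_cvg do rewrite e.
rewrite (_ : _ ^-1 = \prod_(i < n) (Q%:R : R)^-1); last by rewrite prodr_const card_ord exprVn.
by apply: cvg_big; [exact: mul_continuous|move=> i _; exact: interval_density].
Qed.

Lemma cube_volume_gt0 : \forall L \near \oo, 0 < cube_volume R n L.
Proof.
near=> L; rewrite exprn_gt0// mulr_gt0// ltr0n; near: L; exact: nbhs_infty_gt.
Unshelve. all: by end_near.
Qed.

Lemma cube_volume_large :
  \forall L \near \oo, ((2 * L).+1%:R) ^+ n <= 2 ^+ n * cube_volume R n L.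
Proof.
near=> L; rewrite -exprMn lerXn2r ?nnegrE ?mulr_ge0//.
have L0 : (0 < L)%N by near: L; exact: nbhs_infty_gt.
by rewrite mulrA -!natrM ler_nat; lia.
Unshelve. all: by end_near.
Qed.

End CubeDensity.

(** * Averaging over balls *)

Section OuterMeasure.
Variables (R : realType) (n' : nat).
Local Notation n := n'.+1.
Implicit Types (a b x : 'rV[R]_n).

Definition box_volume a b : R := \prod_(i < n) (b 0 i - a 0 i).
Definition box a b : set 'rV[R]_n := [set x | forall i, a 0 i <= x 0 i <= b 0 i].
Definition eball (r : R) : set 'rV[R]_n := [set x | \sum_(i < n) x 0 i ^+ 2 <= r ^+ 2].

Lemma box_volume_ge0 a b : (forall i, a 0 i <= b 0 i) -> 0 <= box_volume a b.
Proof. by move=> ab; apply: prodr_ge0 => i _; rewrite subr_ge0. Qed.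

Lemma lebesgue_outer_ge0 (A : set 'rV[R]_n) : (0 <= lebesgue_outer A)%E.
Proof.
apply: le_ereal_inf_tmp => _ [a [b [ab _ ->]]]; apply: nneseries_ge0 => k _ _.
by rewrite lee_fin; apply: box_volume_ge0.
Qed.

(** The finite family is extended to a sequence by the default box [0, 0], whose volume is 0 because
    the dimension is positive. *)
Lemma lebesgue_outer_cover (I : choiceType) (s : seq I) (a b : I -> 'rV[R]_n)
    (A : set 'rV[R]_n) : (forall i j, a i 0 j <= b i 0 j) ->
  A `<=` \bigcup_(i in [set` s]) box (a i) (b i) ->
  (lebesgue_outer A <= (\sum_(i <- s) box_volume (a i) (b i))%:E)%E.
Proof.
move=> ab As.
pose ext (c : I -> 'rV[R]_n) k := nth 0 [seq c i | i <- s] k.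
apply: ereal_inf_lbound; exists (ext a), (ext b); split.
- move=> k j; rewrite /ext; have [ks|sk] := ltnP k (size s); last by rewrite !nth_default ?size_map.
  by case: s ks {As ext} => // i0 s ks; rewrite !(nth_map i0).
- move=> x /As [i /= si xi]; exists (index i s) => //= j; rewrite /ext.
  rewrite !(nth_map i) ?index_mem// nth_index//.
pose u k := (\prod_(i < n) (ext b k 0 i - ext a k 0 i))%:E.
have u0 k : (size s <= k)%N -> u k = 0%E.
  move=> sk; rewrite /u /ext !nth_default ?size_map//.
  by rewrite big_ord_recl !mxE subrr mul0r.
have -> : (\sum_(0 <= k <oo) u k)%E = (\sum_(0 <= k < size s) u k)%E.
  apply: lim_near_cst => //; exists (size s) => // N /= sN.
  rewrite (big_cat_nat (leq0n _) sN)/= [X in (_ + X)%E]big1_seq ?adde0// => k.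
  by rewrite mem_index_iota => /andP[_ /andP[/u0]].
case: s As @ext @u u0 => [|i0 s] As ext u u0; first by rewrite big_nil big_geq.
rewrite (big_nth i0) -sumEFin big_nat [RHS]big_nat; apply: eq_bigr => k /andP[_ ks].
by rewrite /u /ext !(nth_map i0).
Qed.

(** Every cover of [A] by boxes, scaled by s, covers [B], and volumes are multiplied by s^n. *)
Lemma lebesgue_outer_scale (s : R) (A B : set 'rV[R]_n) : 0 < s ->
  (forall x, B x -> A (s^-1 *: x)) ->
  (lebesgue_outer B <= (s ^+ n)%:E * lebesgue_outer A)%E.
Proof.
move=> s0 BA; rewrite -lee_pdivrMl ?exprn_gt0//; apply: le_ereal_inf_tmp => _ [a [b [ab Acov ->]]].
rewrite lee_pdivrMl ?exprn_gt0//; apply: ereal_inf_lbound.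
exists (fun k => s *: a k), (fun k => s *: b k); split.
- by move=> k i; rewrite !mxE ler_pM2l.
- move=> x /BA /Acov [k _ kx]; exists k => // i; have := kx i; rewrite !mxE.
  by rewrite ler_pdivlMl// ler_pdivrMl.
rewrite -nneseriesZl; last by move=> k _; rewrite lee_fin; apply: box_volume_ge0.
apply: eq_eseriesr => k _; rewrite -EFinM; congr EFin.
under [RHS]eq_bigr do rewrite !mxE -mulrBr.
by rewrite big_split/= prodr_const card_ord.
Qed.

Lemma eball_coord r x i : eball r x -> `|x 0 i| <= `|r|.
Proof.
move=> h; rewrite -ler_sqr ?nnegrE// !real_normK ?num_real//.
apply: le_trans h; rewrite (bigD1 i)//= lerDl; apply: sumr_ge0 => j _; exact: sqr_ge0.
Qed.

Lemma lebesgue_outer_eball_fin r : lebesgue_outer (eball r) \is a fin_num.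
Proof.
rewrite ge0_fin_numE ?lebesgue_outer_ge0//.
apply: le_lt_trans (ltry _).
apply: (@lebesgue_outer_cover unit [:: tt] (fun=> const_mx (- `|r|)) (fun=> const_mx `|r|)).
  by move=> _ j; rewrite !mxE ge0_cp.
move=> x xr; exists tt => //= i; rewrite !mxE -ler_norml; exact: eball_coord xr.
Qed.

Definition unit_ball_volume : R := fine (lebesgue_outer (eball 1)).

Lemma lebesgue_outer_eball1 : lebesgue_outer (eball 1) = unit_ball_volume%:E.
Proof. by rewrite fineK// lebesgue_outer_eball_fin. Qed.

(** The two inequalities come from scaling by r and by its inverse. *)
Lemma ball_volumeE (r : R) : 0 < r -> ball_volume n r = r ^+ n * unit_ball_volume.
Proof.
move=> r0; rewrite /ball_volume -/(eball r).
suff -> : lebesgue_outer (eball r) = ((r ^+ n)%:E * lebesgue_outer (eball 1))%E.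
  by rewrite lebesgue_outer_eball1.
have scale (s t : R) x : 0 < s -> eball t x -> eball (t / s) (s^-1 *: x).
  move=> s0; rewrite /eball/= => h; under eq_bigr do rewrite mxE exprMn.
  by rewrite -mulr_sumr exprMn mulrC ler_wpM2r// sqr_ge0.
apply/eqP; rewrite eq_le lebesgue_outer_scale//=; last first.
  by move=> x /(scale r _ _ r0); rewrite divff// gt_eqF.
rewrite -lee_pdivlMl ?exprn_gt0// -exprVn; apply: lebesgue_outer_scale; rewrite ?invr_gt0//.
move=> x /(scale r^-1); rewrite invr_gt0 => /(_ r0).
by rewrite invrK mul1r.
Qed.

End OuterMeasure.

(** * Points of a residue class in large balls *)

Section LatticePoints.
Variables (R : realType) (n' : nat).
Local Notation n := n'.+1.
Variables (Q : nat) (c : 'rV[int]_n).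
Hypothesis Q0 : (0 < Q)%N.
Local Notation ubv := (unit_ball_volume R n').
Let QR : 0 < Q%:R :> R. Proof. by rewrite ltr0n. Qed.

Definition lattice_ball (t : R) : set 'rV[int]_n :=
  [set a | \sum_(i < n) (a 0 i)%:~R ^+ 2 <= t ^+ 2] `&`
  [set a | forall i, progression Q (c 0 i) (a 0 i)].

Lemma lattice_box (al be : 'rV[R]_n) : (forall i, al 0 i <= be 0 i) ->
  let X := [set a : 'rV[int]_n | forall i, ([set k | al 0 i <= k%:~R <= be 0 i] `&`
              progression Q (c 0 i)) (a 0 i)] in
  finite_set X /\ (card X)%:R <= \prod_(i < n) ((be 0 i - al 0 i) / Q%:R + 1) :> R.
Proof.
move=> ab X; pose f i := progression_interval (c 0 i) Q0 (ab i).
have [fX ->] := card_rows (fun i => (f i).1); split => //.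
by rewrite natr_prod; apply: ler_prod => i _; rewrite ler0n /= (f i).2.
Qed.

Lemma lattice_ball_finite t : finite_set (lattice_ball t).
Proof.
have [|fX _] := @lattice_box (const_mx (- `|t|)) (const_mx `|t|).
  by move=> i; rewrite !mxE ge0_cp.
apply: sub_finite_set fX => a [at_ ac] i; split; last exact: ac.
have : eball t (\row_i (a 0 i)%:~R : 'rV[R]_n).
  by rewrite /eball/=; under eq_bigr do rewrite mxE.
by move=> /eball_coord => /(_ i); rewrite /= !mxE ler_norml.
Qed.

(* The cubes of side [Q] whose lower corners are the points of the class
   cover the ball of radius [t]; the corners are at distance at most [t + C]. *)
Lemma unit_ball_volume_le (t : R) : 0 < t ->
  ubv <= (Q%:R / t) ^+ n * (card (lattice_ball (t + (1 + n%:R * Q%:R ^+ 2))))%:R.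
Proof.
move=> t0; set C := 1 + _; set X := lattice_ball _.
have fX : finite_set X by exact: lattice_ball_finite.
rewrite -lee_fin -lebesgue_outer_eball1.
pose lo (a : 'rV[int]_n) : 'rV[R]_n := \row_i ((a 0 i)%:~R / t).
pose hi (a : 'rV[int]_n) : 'rV[R]_n := \row_i (((a 0 i)%:~R + Q%:R) / t).
have loE b i : lo b 0 i = (b 0 i)%:~R / t by rewrite mxE.
have hiE b i : hi b 0 i = ((b 0 i)%:~R + Q%:R) / t by rewrite mxE.
apply: le_trans (@lebesgue_outer_cover _ _ _ (fset_set X) lo hi _ _ _) _.
- by move=> a i; rewrite !mxE ler_pM2r ?invr_gt0// lerDl ltW.
(* Each coordinate of t x is rounded down to the progression of step Q; this gives the lower corner
   [a] of the cube containing t x. *)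
- move=> x x1; pose z i := Num.floor ((t * x 0 i - (c 0 i)%:~R) / Q%:R).
  pose a : 'rV[int]_n := \row_i (z i * Q%:Z + c 0 i).
  have aR i : (a 0 i)%:~R = (z i)%:~R * Q%:R + (c 0 i)%:~R :> R.
    by rewrite mxE rmorphD rmorphM.
  have alo i : (a 0 i)%:~R <= t * x 0 i.
    by rewrite aR -lerBrDr -ler_pdivlMr// ge_floor.
  have ahi i : t * x 0 i <= (a 0 i)%:~R + Q%:R.
    rewrite aR; have := ltW (floorD1_gt ((t * x 0 i - (c 0 i)%:~R) / Q%:R)).
    rewrite rmorphD/= ler_pdivrMr// mulrDl mul1r -/(z i); lra.
  exists a => /=; last first.
    move=> i; have := alo i; have := ahi i; rewrite loE hiE.
    by rewrite ler_pdivrMr// ler_pdivlMr// mulrC => -> ->.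
  rewrite in_fset_set//; apply/mem_set; split; last first.
    by move=> i; rewrite /progression/= mxE addrK dvdz_mull.
  rewrite /=.
  (* The weighted inequality w^2 <= (1 + 1/t) u^2 + (1 + t) (w - u)^2, whose defect is the square (u
     - t (w - u))^2 divided by t. It can be summed over the coordinates without square roots. *)
  have sq i : (a 0 i)%:~R ^+ 2 <= (1 + t^-1) * (t * x 0 i) ^+ 2 + (1 + t) * Q%:R ^+ 2.
    have h1 := alo i; have h2 := ahi i.
    set u := t * x 0 i in h1 h2 *; set w := (a 0 i)%:~R in h1 h2 *.
    have v2 : (w - u) ^+ 2 <= Q%:R ^+ 2.
      by rewrite -[(w - u) ^+ 2]sqrrN lerXn2r ?nnegrE//; lra.
    apply: (@le_trans _ _ ((1 + t^-1) * u ^+ 2 + (1 + t) * (w - u) ^+ 2)); last first.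
      by rewrite lerD2l ler_wpM2l// addr_ge0// ltW.
    rewrite -subr_ge0.
    have -> : (1 + t^-1) * u ^+ 2 + (1 + t) * (w - u) ^+ 2 - w ^+ 2 = (u - t * (w - u)) ^+ 2 / t.
      by field; rewrite gt_eqF.
    by rewrite divr_ge0 ?sqr_ge0// ltW.
  apply: le_trans (ler_sum _ (fun i _ => sq i)) _.
  rewrite big_split/= sumr_const card_ord -mulr_sumr.
  apply: (@le_trans _ _ ((1 + t^-1) * t ^+ 2 + n%:R * ((1 + t) * Q%:R ^+ 2))).
    rewrite mulr_natl lerD2r ler_wpM2l ?addr_ge0 ?invr_ge0 ?(ltW t0)//.
    under eq_bigr do rewrite exprMn.
    rewrite -mulr_sumr -[leRHS]mulr1 ler_wpM2l ?sqr_ge0//.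
    by move: x1; rewrite /eball/= expr1n.
  have -> : (1 + t^-1) * t ^+ 2 + n%:R * ((1 + t) * Q%:R ^+ 2) = t ^+ 2 + t + (1 + t) * (C - 1).
    by rewrite /C; field; rewrite gt_eqF.
  have C1 : 1 <= C by rewrite lerDl mulr_ge0// sqr_ge0.
  (* What remains is t^2 + C t + C - 1 <= (t + C)^2. *)
  nra.
rewrite lee_fin; under eq_bigr => a _.
  rewrite (_ : box_volume (lo a) (hi a) = (Q%:R / t) ^+ n); last first.
    rewrite /box_volume; under eq_bigr do rewrite !mxE -mulrBl addrAC subrr add0r.
    by rewrite prodr_const card_ord.
  over.
by rewrite big_const_seq count_predT iter_addr_0 -[leLHS]mulr_natr lexx.
Qed.

Lemma eball_compact : compact (eball (n' := n') (1 : R)).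
Proof.
have cube_compact : compact [set x : 'rV[R]_n | forall i, `[(-1 : R), 1]%classic (x ord0 i)].
  by apply: (@rV_compact R n (fun=> `[(-1 : R), 1]%classic)) => _; exact: segment_compact.
apply: subclosed_compact cube_compact _; last first.
  by move=> x /eball_coord h i; rewrite /= in_itv/= -ler_norml; have := h i; rewrite normr1.
apply: (@closed_comp _ _ (fun x : 'rV[R]_n => \sum_(i < n) x 0 i ^+ 2) [set y | y <= 1 ^+ 2]).
  move=> x _; apply: cvg_big; [exact: add_continuous|exact: nbhs_filter|move=> i _].
  have cc : (fun y : 'rV[R]_n => y 0 i) @ x --> x 0 i by exact: coord_continuous.
  exact: (cvgM cc cc).
exact: closed_le.
Qed.

(** The volume is continuous in the side lengths. The enlargement leaves room for open boxes in the
    compactness argument. *)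
Lemma box_volume_perturb (a b : 'rV[R]_n) (e : R) : 0 < e ->
  exists2 d, 0 < d & \prod_(i < n) (b 0 i - a 0 i + 2 * d) <= box_volume a b + e.
Proof.
move=> e0.
have : \prod_(i < n) (b 0 i - a 0 i + 2 * d) @[d --> (0 : R)^'+] --> \prod_(i < n) (b 0 i - a 0 i + 2 * 0).
  apply: cvg_big; first exact: mul_continuous.
  move=> i _; apply: cvg_at_right_filter; apply: cvgD; first exact: cvg_cst.
  by apply: cvgM; [exact: cvg_cst|exact: cvg_id].
have -> : \prod_(i < n) (b 0 i - a 0 i + 2 * 0) = box_volume a b.
  by apply: eq_bigr => i _; rewrite mulr0 addr0.
move=> /cvgrPdist_le /(_ e e0) h.
have : \forall d \near (0 : R)^'+, 0 < d /\ \prod_(i < n) (b 0 i - a 0 i + 2 * d) <= box_volume a b + e.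
  near=> d; split; first by [].
  have : `|box_volume a b - \prod_(i < n) (b 0 i - a 0 i + 2 * d)| <= e by near: d.
  rewrite ler_norml => /andP[]; lra.
by move=> /filter_ex [d [d0 hd]]; exists d.
Unshelve. all: by end_near.
Qed.

Lemma open_box (a b : 'rV[R]_n) : open [set x : 'rV[R]_n | forall i, a 0 i < x 0 i < b 0 i].
Proof.
rewrite openE => x xab; rewrite /interior.
apply: (@filter_forall _ _ _ _ (nbhs_filter x)) => i.
have xi : x 0 i \in `]a 0 i, b 0 i[ by rewrite in_itv/=.
have cc : (fun y : 'rV[R]_n => y 0 i) @ x --> x 0 i by exact: coord_continuous.
apply: (@filterS _ _ (nbhs_filter x) _ _ _ (cc _ (near_in_itvoo xi))) => y.
by rewrite /= in_itv.
Qed.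

(** A finite subcover comes with an arbitrary finite set of indices, whereas a series is controlled
    through its initial sums. *)
Lemma sum_fset_le_prefix (D : {fset nat}) : exists N, forall f : nat -> R,
  (forall k, 0 <= f k) -> \sum_(k <- D) f k <= \sum_(0 <= k < N) f k.
Proof.
pose N := (\max_(k <- D) k.+1)%N.
have t k : k \in D -> (k < N)%N by move=> kD; apply: (leq_bigmax_seq (F := succn)).
exists N => f f0; rewrite [leRHS](bigID (mem D))/=.
rewrite -[leLHS]addr0 lerD//; last by apply: sumr_ge0.
rewrite -[leRHS]big_filter le_eqVlt; apply/orP; left; apply/eqP; apply: perm_big.
apply: uniq_perm; rewrite ?filter_uniq ?iota_uniq ?fset_uniq// => k.
by rewrite mem_filter mem_index_iota /=; case: (boolP (k \in D)) => //= /t ->.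
Qed.

Lemma sum_half_powers (D : {fset nat}) (e : R) : 0 <= e ->
  \sum_(k <- D) e / 2 ^+ k.+1 <= e.
Proof.
move=> e0; have [N hN] := sum_fset_le_prefix D.
apply: le_trans (hN (fun k => e / 2 ^+ k.+1) _) _.
  by move=> k; rewrite divr_ge0 ?exprn_ge0.
rewrite big_mkord.
elim: N {hN} e e0 => [|N IH] e e0; first by rewrite big_ord0.
rewrite big_ord_recl /= expr1.
have := IH (e / 2) (divr_ge0 e0 (ler0n _ 2)).
rewrite (eq_bigr (fun i : 'I_N => e / 2 ^+ (bump 0 i).+1)); first lra.
by move=> i _; rewrite /bump leq0n add1n [in RHS]exprS invfM mulrA.
Qed.

(* Heine-Borel: a countable cover by closed boxes yields, after a small
   enlargement, a finite cover by boxes of almost the same total volume, and a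
   box contains at most [\prod (t * side / Q + 1)] points of the class. *)
Lemma lattice_ball_upper (e : R) : 0 < e ->
  \forall t \near +oo, (Q%:R / t) ^+ n * (card (lattice_ball t))%:R <= ubv + e.
Proof.
(* One third of e pays for the near-optimal cover, one for the enlargement of the boxes, one for the
   limit in t. *)
move=> e0; have e3 : 0 < e / 3 by rewrite divr_gt0.
have [v [a [b [ab acov vE]]] vlt] :=
  lb_ereal_inf_adherent e3 (lebesgue_outer_eball_fin n' (1 : R)).
pose w k := box_volume (a k) (b k).
have w0 k : 0 <= w k by exact: box_volume_ge0.
have wD (D : {fset nat}) : \sum_(k <- D) w k <= ubv + e / 3.
  rewrite -lee_fin EFinD -lebesgue_outer_eball1; apply: (@le_trans _ _ v); last exact: ltW.
  rewrite vE; have [N hN] := sum_fset_le_prefix D.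
  apply: (@le_trans _ _ (\sum_(0 <= k < N) (w k)%:E)%E); last first.
    by apply: nneseries_lim_ge => k _ _; rewrite lee_fin.
  by rewrite sumEFin lee_fin; exact: hN.
have dP k : exists d, 0 < d /\ \prod_(i < n) (b k 0 i - a k 0 i + 2 * d) <= w k + (e / 3) / 2 ^+ k.+1.
  have ek : 0 < (e / 3) / 2 ^+ k.+1 by rewrite divr_gt0// exprn_gt0.
  by have [d d0 hd] := box_volume_perturb (a k) (b k) ek; exists d.
pose d k := projT1 (cid (dP k)).
have d0 k : 0 < d k by rewrite /d; case: cid => ? [].
have dw k : \prod_(i < n) (b k 0 i - a k 0 i + 2 * d k) <= w k + (e / 3) / 2 ^+ k.+1.
  by rewrite /d; case: cid => ? [].
pose a' k : 'rV[R]_n := \row_i (a k 0 i - d k).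
pose b' k : 'rV[R]_n := \row_i (b k 0 i + d k).
have := eball_compact; rewrite compact_cover.
move=> /(_ nat setT (fun k => [set x : 'rV[R]_n | forall i, a' k 0 i < x 0 i < b' k 0 i])).
case=> [k _|x /acov [k _ kx]|D _ Dcov].
- exact: open_box.
- exists k => // i; have := kx i; have := d0 k; rewrite !mxE => dk /andP[h1 h2].
  by apply/andP; split; lra.
pose s k i : R := b k 0 i - a k 0 i + 2 * d k.
(* A box with sides s scaled by t holds at most the product of the t s / Q + 1 points; multiplied by
   (Q / t)^n this becomes the product of the s + Q / t. *)
have lim : \sum_(k <- D) \prod_(i < n) (s k i + Q%:R / t) @[t --> +oo] -->
    \sum_(k <- D) \prod_(i < n) (s k i + 0).
  apply: cvg_big; first exact: add_continuous.
  move=> k _; apply: cvg_big; first exact: mul_continuous.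
  move=> i _; apply: cvgD; first exact: cvg_cst.
  rewrite -(mulr0 Q%:R); apply: cvgM; first exact: cvg_cst.
  by apply/gtr0_cvgV0; [exact: nbhs_pinfty_gt|exact: cvg_id].
have lim_le : \sum_(k <- D) \prod_(i < n) (s k i + 0) <= ubv + e / 3 + e / 3.
  apply: (@le_trans _ _ (\sum_(k <- D) (w k + (e / 3) / 2 ^+ k.+1))).
    apply: ler_sum => k _; apply: le_trans (dw k).
    by rewrite le_eqVlt; apply/orP; left; apply/eqP; apply: eq_bigr => i _; rewrite addr0.
  by rewrite big_split/= lerD// sum_half_powers// ltW.
move/cvgrPdist_le : lim => /(_ _ e3) lim.
near=> t; have t0 : 0 < t by near: t; exact: nbhs_pinfty_gt.
apply: (@le_trans _ _ (\sum_(k <- D) \prod_(i < n) (s k i + Q%:R / t))); last first.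
  have : `|\sum_(k <- D) \prod_(i < n) (s k i + 0) -
           \sum_(k <- D) \prod_(i < n) (s k i + Q%:R / t)| <= e / 3 by near: t.
  rewrite ler_norml; move: lim_le.
  move: (\sum_(k <- D) _) (\sum_(k <- D) _) => x y; move: ubv => z *; lra.
pose al k : 'rV[R]_n := t *: a' k; pose be k : 'rV[R]_n := t *: b' k.
have albe k i : al k 0 i <= be k 0 i.
  by rewrite !mxE ler_pM2l//; have := d0 k; have := ab k i; lra.
pose X k := [set z : 'rV[int]_n | forall i, ([set l | al k 0 i <= l%:~R <= be k 0 i] `&`
              progression Q (c 0 i)) (z 0 i)].
have fX k : finite_set (X k) by have [] := lattice_box (albe k).
apply: (@le_trans _ _ ((Q%:R / t) ^+ n * \sum_(k <- D) (card (X k))%:R)).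
  rewrite ler_wpM2l ?exprn_ge0 ?divr_ge0 ?(ltW t0)// -natr_sum ler_nat.
  apply: leq_trans (card_bigcup_le _); last by move=> k _; exact: fX.
  apply: card_sub; first by apply: bigcup_finite.
  move=> z [/= zt zc].
  have : eball 1 (\row_i ((z 0 i)%:~R / t) : 'rV[R]_n).
    rewrite /eball/=; under eq_bigr do rewrite mxE exprMn.
    by rewrite -mulr_suml expr1n exprVn ler_pdivrMr ?exprn_gt0// mul1r.
  move=> /Dcov [k /= kD kz]; exists k => // i; split; last exact: zc.
  have := kz i; rewrite /= !mxE ltr_pdivlMr// ltr_pdivrMr// => /andP[h1 h2].
  by rewrite mulrC ltW//= mulrC ltW.
rewrite mulr_sumr; apply: ler_sum => k _.
have [_ hX] := lattice_box (albe k).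
apply: le_trans (ler_wpM2l _ hX) _; first by rewrite exprn_ge0// divr_ge0// ltW.
have -> : (Q%:R / t) ^+ n = \prod_(i < n) (Q%:R / t) by rewrite prodr_const card_ord.
rewrite -big_split/= le_eqVlt; apply/orP; left; apply/eqP.
apply: eq_bigr => i _; rewrite !mxE /s; field.
by rewrite !gt_eqF.
Unshelve. all: by end_near.
Qed.

Lemma lattice_ball_cvg :
  (Q%:R / t) ^+ n * (card (lattice_ball t))%:R @[t --> +oo] --> ubv.
Proof.
pose C : R := 1 + n%:R * Q%:R ^+ 2.
have low : ubv * (1 - C / t) ^+ n @[t --> +oo] --> ubv * (1 - C * 0) ^+ n.
  have c1 : 1 - C / t @[t --> +oo] --> 1 - C * 0.
    apply: cvgB; first exact: cvg_cst.
    apply: cvgM; first exact: cvg_cst.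
    by apply/gtr0_cvgV0; [exact: nbhs_pinfty_gt|exact: cvg_id].
  apply: cvgM; first exact: cvg_cst.
  rewrite -[n in _ ^+ n]card_ord -prodr_const.
  under eq_cvg do rewrite -[n in _ ^+ n]card_ord -prodr_const.
  by apply: cvg_big => //; exact: mul_continuous.
rewrite mulr0 subr0 expr1n mulr1 in low.
apply/cvgrPdist_le => e e0; move/cvgrPdist_le : low => /(_ e e0) low.
have up := lattice_ball_upper e0.
near=> t.
have t0 : 0 < t by near: t; exact: nbhs_pinfty_gt.
have tC : C < t by near: t; apply: nbhs_pinfty_gt; exact: num_real.
have h1 : (Q%:R / t) ^+ n * (card (lattice_ball t))%:R <= ubv + e by near: t.
have h2 : `|ubv - ubv * (1 - C / t) ^+ n| <= e by near: t.
have h3 : ubv * (1 - C / t) ^+ n <= (Q%:R / t) ^+ n * (card (lattice_ball t))%:R.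
  (* The lower bound is [unit_ball_volume_le] at radius t - C, so that the corners stay in the ball
     of radius t; the factor (1 - C / t)^n restores the normalisation by t. *)
  have tC0 : 0 < t - C by rewrite subr_gt0.
  have := unit_ball_volume_le tC0; rewrite -/C subrK => h.
  have q0 : 0 <= (1 - C / t) ^+ n.
    by rewrite exprn_ge0// subr_ge0 ler_pdivrMr// mul1r ltW.
  apply: le_trans (ler_wpM2r q0 h) _.
  rewrite mulrAC -exprMn le_eqVlt; apply/orP; left; apply/eqP; congr (_ ^+ _ * _).
  by field; rewrite !gt_eqF.
by move: h2; rewrite !ler_norml => /andP[h4 h5]; apply/andP; split; lra.
Unshelve. all: by end_near.
Qed.

End LatticePoints.

Section BallVolumePositive.
Variables (R : realType) (n' : nat).
Local Notation n := n'.+1.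

(** An outer measure is hard to bound from below directly, so positivity is read off the lattice
    point limit with Q = 1. The ball of radius t contains the integer points of [0, t / n]^n, since
    n (t / n)^2 <= t^2, and there are at least (t / n)^n of them. *)
Lemma unit_ball_volume_gt0 : 0 < unit_ball_volume R n'.
Proof.
have := @lattice_ball_cvg R n' 1 0 isT.
have nn : 0 < n%:R :> R by rewrite ltr0n.
suff : \forall t \near +oo, (n%:R ^+ n)^-1 <=
    (1 / t) ^+ n * (card (lattice_ball 1 0 (t : R) : set 'rV[int]_n))%:R.
  move=> h hc; apply: lt_le_trans (cvgr_to_ge hc h).
  by rewrite invr_gt0 exprn_gt0.
near=> t; have t0 : 0 < t by near: t; exact: nbhs_pinfty_gt.
pose k := Num.truncn (t / n%:R).
have tn : 0 <= t / n%:R by rewrite divr_ge0// ltW.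
apply: (@le_trans _ _ ((1 / t) ^+ n * (k.+1 ^ n)%:R)).
  rewrite natrX -exprMn -exprVn lerXn2r ?nnegrE ?invr_ge0 ?mulr_ge0 ?invr_ge0 ?(ltW t0)//.
  rewrite mul1r mulrC ler_pdivlMr// mulrC ltW//; exact: truncnS_gt.
rewrite ler_wpM2l ?exprn_ge0 ?divr_ge0 ?(ltW t0)// ler_nat.
rewrite -[X in (X ^ _ <= _)%N]card_ord -[n in (_ ^ n <= _)%N]mul1n -card_mx -card_setT.
apply: (leq_card_inj (f := fun g : 'rV['I_k.+1]_n => map_mx (fun i : 'I_k.+1 => (i : nat)%:Z) g)).
- exact: lattice_ball_finite.
- move=> g _; split; last by move=> i; rewrite /progression/= dvd1z.
  have gt i : ((map_mx (fun i : 'I_k.+1 => (i : nat)%:Z) g) 0 i)%:~R ^+ 2 <= (t / n%:R) ^+ 2 :> R.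
    rewrite mxE; have gk : (g 0 i : nat)%:R <= t / n%:R :> R.
      apply: (@le_trans _ _ k%:R); last by rewrite truncn_le.
      by rewrite ler_nat -ltnS ltn_ord.
    by rewrite lerXn2r ?nnegrE.
  apply: le_trans (ler_sum _ (fun i _ => gt i)) _.
  rewrite sumr_const card_ord -[leLHS]mulr_natl.
  have -> : n%:R * (t / n%:R) ^+ 2 = t ^+ 2 / n%:R by field; rewrite gt_eqF.
  by rewrite ler_pdivrMr// -[leLHS]mulr1 ler_wpM2l ?sqr_ge0// ler1n.
- move=> g h _ _ /rowP e; apply/rowP => i; have := e i; rewrite !mxE => -[].
  exact: val_inj.
Unshelve. all: by end_near.
Qed.

End BallVolumePositive.

Section BallDensity.
Variables (R : realType) (O : comNzRingType) (n' : nat).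
Local Notation n := n'.+1.
Variables (E : 'I_n -> O).
Hypothesis (hE : Zbasis E).

Lemma ball_sub_cube (r : R) : ball_lattice E r `<=` cube_lattice E (Num.truncn `|r|).
Proof.
move=> _ [a ar <-]; apply/(cubeP hE) => i; rewrite combK truncn_ge_nat//.
have : eball r (\row_i (a 0 i)%:~R : 'rV[R]_n).
  by rewrite /eball/=; under eq_bigr do rewrite mxE.
by move=> /eball_coord => /(_ i); rewrite mxE -intr_norm pmulrn abszE.
Qed.

Lemma ball_equidistributed (Q : nat) (c : O) : (0 < Q)%N ->
  (card (ball_lattice E r `&` [set y | exists w, y - c = w *+ Q]))%:R / ball_volume n r
   @[r --> +oo] --> ((Q%:R : R) ^+ n)^-1.
Proof.
move=> Q0; have v0 := unit_ball_volume_gt0 R n'.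
have Qn : (Q%:R : R) ^+ n != 0 by rewrite expf_neq0// pnatr_eq0 -lt0n.
have h := @lattice_ball_cvg R n' Q (coord hE c) Q0.
have {h} : (Q%:R / r) ^+ n * (card (lattice_ball Q (coord hE c) r))%:R *
    (Q%:R ^+ n * unit_ball_volume R n')^-1 @[r --> +oo] -->
    unit_ball_volume R n' * (Q%:R ^+ n * unit_ball_volume R n')^-1.
  by apply: cvgM; [exact: h|exact: cvg_cst].
rewrite invfM mulrCA divff ?gt_eqF// mulr1; apply: cvg_trans; apply: near_eq_cvg.
near=> r; have r0 : 0 < r by near: r; exact: nbhs_pinfty_gt.
rewrite ball_volumeE// card_combination; last first.
  have := @lattice_ball_finite R n' 1 0 isT r; apply: sub_finite_set => a ar.
  by split => // i; rewrite /progression/= dvd1z.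
rewrite -/(lattice_ball Q (coord hE c) r) expr_div_n; field.
by rewrite Qn expf_neq0 ?gt_eqF.
Unshelve. all: by end_near.
Qed.

Lemma ball_volume_gt0 : \forall r \near +oo, 0 < ball_volume n (r : R).
Proof.
near=> r; have r0 : 0 < r by near: r; exact: nbhs_pinfty_gt.
by rewrite ball_volumeE// mulr_gt0 ?exprn_gt0// unit_ball_volume_gt0.
Unshelve. all: by end_near.
Qed.

Lemma ball_volume_large : \forall r \near +oo,
  ((2 * Num.truncn `|r : R|).+1%:R) ^+ n <= (3 ^+ n / unit_ball_volume R n') * ball_volume n r.
Proof.
near=> r; have r1 : 1 <= r by near: r; exact: nbhs_pinfty_ge.
have r0 : 0 < r by exact: lt_le_trans r1.
rewrite ball_volumeE// (mulrC (r ^+ n)) mulrA divfK ?gt_eqF ?unit_ball_volume_gt0//.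
(* For r >= 1 the number 2 floor(r) + 1 is at most 3 r, whence the constant 3^n. *)
rewrite -exprMn lerXn2r ?nnegrE ?mulr_ge0 ?(ltW r0)// gtr0_norm// -natr1 natrM.
have : (Num.truncn r)%:R <= r by rewrite truncn_le ltW.
lra.
Unshelve. all: by end_near.
Qed.

Lemma truncn_norm_infty : Num.truncn `|r| @[r --> (+oo : set_system R)] --> \oo.
Proof.
apply/cvgnyPge => N; near=> r; rewrite truncn_ge_nat//.
have : N%:R <= r by near: r; apply: nbhs_pinfty_ge; exact: num_real.
by move=> /le_trans; apply; exact: ler_norm.
Unshelve. all: by end_near.
Qed.

End BallDensity.

Theorem corollary1p5 (R : realType) (K : fieldExtType rat) (m : nat)
    (S : {fset 'rV[integers K]_m}) :
  is_PID (integers K) -> (2 <= m)%N -> admissible S ->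
  cvg (partial_prod (@nonzero_primes (integers K))
         (@euler_factor R (integers K) m #|` S|) @ totally) /\
  has_density (visible_from S)
    (infinite_prod (@nonzero_primes (integers K))
       (@euler_factor R (integers K) m #|` S|)).
Proof.
move=> PID m2 adm; split.
  apply/cvg_ex; eexists; apply: partial_prod_cvg => P nP.
  by apply: euler_factor_bounds => //; exact: ltnW.
(* The density along a family is established for m = m' + 2 and n = n' + 1; the degree of a number
   field is positive. *)
case: m m2 S adm => [|[|m']]// _ S adm E.
have : (0 < \dim {:K})%N by exact: adim_gt0.
move: E; case: (\dim {:K}) => // n' E _ hE; split.
- apply: (@density_limit R _ n' m' E hE PID _ _ _ _ id _ (2 ^+ n'.+1)) => //.
  + by move=> x; exact: subset_refl.
  + exact: cube_volume_gt0.
  + exact: cube_volume_large.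
  + by move=> Q c Q0; exact: cube_equidistributed.
(* The ball of radius r is enclosed in the cube with bound floor(|r|), whose size is comparable to
   the volume of the ball because the unit ball has positive volume. *)
- apply: (@density_limit R _ n' m' E hE PID _ _ _ _ (fun r => Num.truncn `|r|) _
    (3 ^+ n'.+1 / unit_ball_volume R n')) => //.
  + by move=> r; exact: ball_sub_cube.
  + exact: truncn_norm_infty.
  + exact: ball_volume_gt0.
  + exact: ball_volume_large.
  + by move=> Q c Q0; exact: ball_equidistributed.
Qed.
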